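(* In the setting of the context, suppose assumptions (H1), (H2), (H3), (H4) hold, let $u\in L^2([\zeta,t_2];U)$ be a control function and $x_0\in Z$. Then the Cauchy problem $$(T_\alpha x)(t)+A(t)x(t)=Bu(t)+F(t,x(t)),\qquad x(\zeta)=x_0,$$ has a unique mild solution on $[\zeta,t_2]$ provided that $$M M_1 N<1,\qquad\text{where } M_1=\|\varrho\|_{L^{1/\xi_1}[\zeta,t_2]}.$$
   Context: $Z,U$ are real Hilbert spaces, $\alpha\in(0,1]$, $0\le t_0<t_f$, $t_1=(\alpha t_0)^{1/\alpha}$, $t_2=(\alpha t_f)^{1/\alpha}$ (so $t^\alpha/\alpha\in[t_0,t_f]$ iff $t\in[t_1,t_2]$), $\zeta\in[t_0,t_f]\cap[t_1,t_2]$, $\zeta<t_2$. $T_\alpha$ is the conformable derivative $(T_\alpha f)(t)=\lim_{\epsilon\to0}\frac{f(t+\epsilon t^{1-\alpha})-f(t)}{\epsilon}$. $B:U\to Z$ is bounded linear, $F:[\zeta,t_2]\times Z\to Z$, $d(s,\alpha)=s^{\alpha-1}ds$, and $W_r=\{x\in C([\zeta,t_2];Z):\|x(\cdot)\|\le r\}$. Assumptions on the operators $A(t)$ in $Z$, $t_0\le t^\alpha/\alpha\le t_f$: $\sigma(A(t))\subset\{\lambda\in\mathbb C:|\arg\lambda|<\omega\}$ with fixed $0<\omega<\pi/2$; (a) $A(t)$ is closed with dense domain $D(A(t))$ independent of $t$; (b) the resolvent $R_\alpha(\lambda,A(t))$ exists for $\mathrm{Re}\,\lambda\le0$ and $\|R_\alpha(\lambda,A(t))\|\le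 K_\alpha/(|\lambda|+1)$ for a constant $K_\alpha>0$; (c) there are $0<\delta\le1$, $K>0$ with $\|(A(t)-A(s))A^{-1}(\tau)\|\le K|t^\alpha-s^\alpha|^\delta$ for all $\frac{t^\alpha}{\alpha},\frac{s^\alpha}{\alpha},\frac{\tau^\alpha}{\alpha}\in[t_0,t_f]$; (d) $R_\alpha(\lambda,A(t))$ is compact for each $t$ and some $\lambda\in\rho(A(t))$. $\Psi_\alpha(t,s)$ is the (unique) evolution operator of $(T_\alpha x)(t)+A(t)x(t)=0$: bounded operators with $\Psi_\alpha(s,s)=I$, $\Psi_\alpha(t,r)\Psi_\alpha(r,s)=\Psi_\alpha(t,s)$ for $s\le r\le t$, strongly continuous, with $T_\alpha(\Psi_\alpha(\cdot,s))(t)+A(t)\Psi_\alpha(t,s)=0$ for $s<t$. $M$ is a constant with $\|\Psi_\alpha(t,s)\|\le M$ for $s\le t$. A mild solution, for control $u\in L^2([\zeta,t_2];U)$, is $x\in C([\zeta,t_2];Z)$ with $x(t)=\Psi_\alpha(t,\zeta)x_0+\int_\zeta^t\Psi_\alpha(t,s)Bu(s)\frac{ds}{s^{1-\alpha}}+\int_\zeta^t\Psi_\alpha(t,s)F(s,x(s))\frac{ds}{s^{1-\alpha}}$ for $t\in[\zeta,t_2]$. (The control integrals are regarded as well defined for $u\in L^2$.) (H1) For each $t\in[\zeta,t_2]$, $F(t,\cdot):Z\to Z$ is continuous; for each $x\in Z$, $F(\cdot,x)$ is strongly measurable on $[\zeta,t_2]$; and there are constants $0\le\xi<\min\{\alpha,\delta\}$,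 $\gamma>0$ and, for each $r>0$, a function $h_r\in L^{1/\xi}([\zeta,t_2];\mathbb R^+)$ with $\sup_{\|x\|\le r}\|F(t,x)\|\le h_r(t)$ for a.e. $t\in[\zeta,t_2]$ and $\liminf_{r\to+\infty}\frac{\|h_r\|_{L^{1/\xi}}}{r}=\gamma<\infty$ ($L^{1/0}=L^\infty$). (H2) The linear system $(T_\alpha z)(t)+A(t)z(t)=Bu(t)+h(t)$, $z(\zeta)=z_0$, $h\in L^{1/\xi}([\zeta,t_2];Z)$, is exactly null controllable on $[\zeta,t_2]$, i.e. $\mathrm{Im}\,L_\zeta^{t_2}\supseteq\mathrm{Im}\,N_\zeta^{t_2}$, where $L_\zeta^{t_2}u=\int_\zeta^{t_2}\Psi_\alpha(t_2,s)Bu(s)\,d(s,\alpha)$ on $L^2([\zeta,t_2];U)$ (regarded as a bounded operator into $Z$) and $N_\zeta^{t_2}(z_0,h)=\Psi_\alpha(t_2,\zeta)z_0+\int_\zeta^{t_2}\Psi_\alpha(t_2,s)h(s)\,d(s,\alpha)$ on $Z\times L^{1/\xi}([\zeta,t_2];Z)$. (H3) For every $r>0$ and $x\in W_r$, the function $t\mapsto F(t,x(t))$ is strongly measurable on $[\zeta,t_2]$. (H4) There exist a constant $0\le\xi_1<\min\{\alpha,\delta\}$ and a function $\varrho\in L^{1/\xi_1}([\zeta,t_2];\mathbb R^+)$ such that for every $r>0$ and all $x,y\in W_r$, $\|F(t,x(t))-F(t,y(t))\|\le\varrho(t)\|x-y\|$ for $t\in[\zeta,t_2]$, where $\|x-y\|$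 is the norm of $C([\zeta,t_2];Z)$. Notation: $$N=\max\Big\{\Big(t_2^{\frac{\alpha-\xi'}{1-\xi'}}-\zeta^{\frac{\alpha-\xi'}{1-\xi'}}\Big)^{1-\xi'}\Big(\frac{1-\xi'}{\alpha-\xi'}\Big)^{1-\xi'}:0\le\xi'<\min\{\alpha,\delta\}\Big\}$$ (read as a supremum, assumed finite). *)

(* Defs.v *)
From HB Require Import structures.
From mathcomp Require Import all_boot all_order all_algebra.
From mathcomp Require Import complex.
From mathcomp Require Import all_classical all_reals all_analysis.

Set Implicit Arguments.
Unset Strict Implicit.
Unset Printing Implicit Defensive.

Import Order.TTheory GRing.Theory Num.Theory.
Import numFieldNormedType.Exports.

Local Open Scope classical_set_scope.
Local Open Scope ring_scope.

(** * Bochner integration for vector-valued functions of a real variable *)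

Section Bochner.
Context {R : realType} {V : normedModType R}.
Local Notation mu := (@lebesgue_measure R).

(* The simple function [sum_i 1_(A_i) c_i]; the A_i need not be disjoint. *)
Record vsimple := VSimple {
  vs_size : nat;
  vs_set : 'I_vs_size -> set (measurableTypeR R);
  vs_val : 'I_vs_size -> V;
  vs_measurable : forall i, measurable (vs_set i) }.

Definition vsimple_fun (s : vsimple) (t : R) : V :=
  \sum_(i < vs_size s) (\1_(vs_set i) t : R) *: vs_val i.
Coercion vsimple_fun : vsimple >-> Funclass.

(* Only used for D of finite measure. *)
Definition vsimple_int (D : set R) (s : vsimple) : V :=
  \sum_(i < vs_size s) fine (mu (vs_set i `&` D)) *: vs_val i.

Definition ae_approx (D : set R) (f : R -> V) (s : nat -> vsimple) : Prop :=
  {ae mu, forall t, D t -> s n t @[n --> \oo] --> f t}.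

Definition strongly_measurable (D : set R) (f : R -> V) : Prop :=
  exists s : nat -> vsimple, ae_approx D f s.

(* f is Bochner integrable on D, with integral v. *)
Definition is_bochner (D : set R) (f : R -> V) (v : V) : Prop :=
  exists s : nat -> vsimple,
    [/\ ae_approx D f s,
        (\int[mu]_(t in D) (`|f t - s n t|)%:E @[n --> \oo] --> 0)%E
      & vsimple_int D (s n) @[n --> \oo] --> v].

(* A strongly measurable f makes `|f| a.e. equal to a Borel function, but not
   necessarily Borel; the integral and the essential supremum are insensitive
   to this. *)
Definition Lp_norm (D : set R) (p : \bar R) (f : R -> V) : \bar R :=
  ('N[mu]_p[(fun t => (`|f t|)%:E) \_ D])%E.

Definition in_Lp (D : set R) (p : \bar R) (f : R -> V) : Prop :=
  strongly_measurable D f /\ (Lp_norm D p f < +oo)%E.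

End Bochner.
Arguments vsimple {R} V.

(* The exponent 1/xi, with 1/0 = +oo. *)
Definition exponent_inv {R : realType} (xi : R) : \bar R :=
  if xi == 0 then +oo%E else (xi^-1)%:E.

(** * Bounded and unbounded operators *)

Definition bounded_linear {R : realType} {V W : normedModType R} (f : V -> W)
  : Prop :=
  linear f /\ exists C : R, forall x, `|f x| <= C * `|x|.

(* The values of [op_fun] outside [op_dom] are irrelevant. *)
Record operator (R : realType) (V : normedModType R) := Operator {
  op_dom : set V;
  op_fun :> V -> V;
  op_dom0 : op_dom 0;
  op_dom_lin : forall (a : R) x y,
    op_dom x -> op_dom y -> op_dom (a *: x + y);
  op_lin : forall (a : R) x y, op_dom x -> op_dom y ->
    op_fun (a *: x + y) = a *: op_fun x + op_fun y }.

Section Operators.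
Context {R : realType} {V : normedModType R}.
Implicit Types (A : operator V) (lam : R[i]).

Definition closed_operator A : Prop :=
  closed [set p : V * V | op_dom A p.1 /\ p.2 = A p.1].

Definition is_inverse A (Ainv : V -> V) : Prop :=
  (forall z, op_dom A (Ainv z) /\ A (Ainv z) = z) /\
  (forall z, op_dom A z -> Ainv (A z) = z).

(* Spectral theory takes place in the complexification of the real space V:
   (x, y) : V * V stands for x + iy, with the Hilbert norm [cnorm] rather than
   the library's max norm on V * V. *)
Definition cnorm (w : V * V) : R := Num.sqrt (`|w.1| ^+ 2 + `|w.2| ^+ 2).

Definition cplx_scale lam (w : V * V) : V * V :=
  (complex.Re lam *: w.1 - complex.Im lam *: w.2,
   complex.Re lam *: w.2 + complex.Im lam *: w.1).

Definition cdom A : set (V * V) := [set w | op_dom A w.1 /\ op_dom A w.2].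

Definition lam_sub A lam (w : V * V) : V * V :=
  cplx_scale lam w - (A w.1, A w.2).

(* Q = (lam - A)^-1, everywhere defined and bounded. *)
Definition is_resolvent A lam (Q : V * V -> V * V) : Prop :=
  [/\ forall w, cdom A (Q w) /\ lam_sub A lam (Q w) = w,
      forall w, cdom A w -> Q (lam_sub A lam w) = w
    & exists C : R, forall w, cnorm (Q w) <= C * cnorm w].

Definition resolvent_set A : set R[i] :=
  [set lam | exists Q, is_resolvent A lam Q].

Definition spectrum A : set R[i] := ~` resolvent_set A.

Definition compact_operator (Q : V * V -> V * V) : Prop :=
  compact (closure (Q @` [set w | cnorm w <= 1])).

End Operators.

(* { lam | |arg lam| < omega } *)
Definition sector {R : realType} (omega : R) : set R[i] :=
  [set lam | exists r theta : R, [/\ 0 < r, `|theta| < omega &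
    lam = Complex (r * cos theta) (r * sin theta)]].

(** * Conformable derivative and evolution operators *)

(* l = (T_alpha f)(t) for a function f on D; the increments range over those
   that stay in D, so the limit is one-sided at an endpoint of an interval. *)
Definition is_conformable_deriv {R : realType} {V : normedModType R}
    (alpha : R) (D : set R) (f : R -> V) (t : R) (l : V) : Prop :=
  e^-1 *: (f (t + e * t `^ (1 - alpha)) - f t)
    @[e --> within [set e | D (t + e * t `^ (1 - alpha))] 0^'] --> l.

Section Parabolic.
Context {R : realType} {Z : normedModType R}.
Implicit Types (A : R -> operator Z).

Definition time_set (alpha t0 tf : R) : set R :=
  [set t | 0 <= t /\ t0 <= t `^ alpha / alpha <= tf].

Record parabolic_family (alpha t0 tf omega Kalpha K delta : R) A : Prop := {
  pf_omega : 0 < omega < pi / 2;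
  pf_Kalpha : 0 < Kalpha;
  pf_K : 0 < K;
  pf_delta : 0 < delta <= 1;
  pf_spectrum : forall t, time_set alpha t0 tf t ->
    spectrum (A t) `<=` sector omega;
  pf_closed : forall t, time_set alpha t0 tf t -> closed_operator (A t);
  pf_dense : forall t, time_set alpha t0 tf t -> dense (op_dom (A t));
  pf_dom : forall t s, time_set alpha t0 tf t -> time_set alpha t0 tf s ->
    op_dom (A t) = op_dom (A s);
  pf_resolvent : forall t lam, time_set alpha t0 tf t -> complex.Re lam <= 0 ->
    exists2 Q, is_resolvent (A t) lam Q &
      forall w, cnorm (Q w) <= Kalpha / (complex.Re `|lam| + 1) * cnorm w;
  pf_holder : forall t s tau Ainv, time_set alpha t0 tf t ->
    time_set alpha t0 tf s -> time_set alpha t0 tf tau ->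
    is_inverse (A tau) Ainv -> forall z,
    `|A t (Ainv z) - A s (Ainv z)|
      <= K * `|t `^ alpha - s `^ alpha| `^ delta * `|z|;
  pf_compact : forall t, time_set alpha t0 tf t ->
    exists lam Q, is_resolvent (A t) lam Q /\ compact_operator Q }.

(* The evolution operator of T_alpha x + A(t) x = 0 on t1 <= s <= t <= t2. *)
Record evolution_operator (alpha t1 t2 : R) A (Psi : R -> R -> Z -> Z) : Prop
  := {
  evo_bounded : forall t s, t1 <= s -> s <= t -> t <= t2 ->
    bounded_linear (Psi t s);
  evo_id : forall s z, t1 <= s -> s <= t2 -> Psi s s z = z;
  evo_comp : forall t r s z, t1 <= s -> s <= r -> r <= t -> t <= t2 ->
    Psi t r (Psi r s z) = Psi t s z;
  evo_continuous : forall z,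
    {within [set p : R * R | [/\ t1 <= p.2, p.2 <= p.1 & p.1 <= t2]],
      continuous (fun p => Psi p.1 p.2 z)};
  (* The equation is understood pointwise on Z (strong derivative). *)
  evo_deriv : forall t s z, t1 <= s -> s < t -> t <= t2 ->
    op_dom (A t) (Psi t s z) /\
    is_conformable_deriv alpha `[s, t2] (fun r => Psi r s z) t
      (- A t (Psi t s z)) }.

End Parabolic.

(** * The control system on [zeta, t2] *)

Section System.
Context {R : realType} {Z U : normedModType R}.
Variables (alpha zeta t2 : R) (Psi : R -> R -> Z -> Z) (B : U -> Z).
Implicit Types (F : R -> Z -> Z) (x y : R -> Z) (u : R -> U).

(* v = int_zeta^t Psi(t, s) g(s) ds / s^(1 - alpha) *)
Definition is_duhamel (g : R -> Z) (t : R) (v : Z) : Prop :=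
  is_bochner `[zeta, t] (fun s => s `^ (alpha - 1) *: Psi t s (g s)) v.

Definition control_integrals_defined : Prop :=
  forall u, in_Lp `[zeta, t2] 2%:E u ->
  forall t, t \in `[zeta, t2] -> exists v, is_duhamel (B \o u) t v.

Definition ImL : set Z :=
  [set v | exists2 u, in_Lp `[zeta, t2] 2%:E u & is_duhamel (B \o u) t2 v].

Definition ImN (xi : R) : set Z :=
  [set v | exists z0 h w, [/\ in_Lp `[zeta, t2] (exponent_inv xi) h,
     is_duhamel h t2 w & v = Psi t2 zeta z0 + w]].

(* L is regarded as a bounded operator from L^2 to Z. *)
Definition L_bounded : Prop :=
  exists C : R, forall u v, in_Lp `[zeta, t2] 2%:E u ->
    is_duhamel (B \o u) t2 v ->
    `|v| <= C * fine (Lp_norm `[zeta, t2] 2%:E u).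

Definition exactly_null_controllable (xi : R) : Prop :=
  L_bounded /\ ImN xi `<=` ImL.

Definition mild_solution F u (x0 : Z) x : Prop :=
  {within `[zeta, t2], continuous x} /\
  forall t, t \in `[zeta, t2] -> exists v w,
    [/\ is_duhamel (B \o u) t v, is_duhamel (fun s => F s (x s)) t w
      & x t = Psi t zeta x0 + v + w].

Definition sup_norm x : R := sup [set `|x t| | t in `[zeta, t2]].

Definition Wball (r : R) x : Prop :=
  {within `[zeta, t2], continuous x} /\
  forall t, t \in `[zeta, t2] -> `|x t| <= r.

Record hypothesis_H1 (delta xi gamma : R) (h : R -> R -> R) F : Prop := {
  H1_continuous : forall t, t \in `[zeta, t2] -> continuous (F t);
  H1_measurable : forall z, strongly_measurable `[zeta, t2] (F ^~ z);
  H1_xi : 0 <= xi < Num.min alpha delta;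
  H1_gamma : 0 < gamma;
  H1_h_ge0 : forall r t, 0 < r -> t \in `[zeta, t2] -> 0 <= h r t;
  H1_h_Lp : forall r, 0 < r ->
    in_Lp (V := R^o) `[zeta, t2] (exponent_inv xi) (h r);
  H1_bound : forall r, 0 < r ->
    {ae lebesgue_measure, forall t : R, t \in `[zeta, t2] ->
      (ereal_sup [set (`|F t z|)%:E | z in [set z | (`|z| <= r)%R]]
         <= (h r t)%:E)%E};
  H1_liminf :
    limf_einf (fun r : R =>
        Lp_norm (V := R^o) `[zeta, t2] (exponent_inv xi) (h r) * (r^-1)%:E)%E
      (pinfty_nbhs R) = gamma%:E }.

Definition hypothesis_H3 F : Prop :=
  forall r x, 0 < r -> Wball r x ->
    strongly_measurable `[zeta, t2] (fun t => F t (x t)).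

Record hypothesis_H4 (delta xi1 : R) (rho : R -> R) F : Prop := {
  H4_xi1 : 0 <= xi1 < Num.min alpha delta;
  H4_rho_ge0 : forall t, t \in `[zeta, t2] -> 0 <= rho t;
  H4_rho_Lp : in_Lp (V := R^o) `[zeta, t2] (exponent_inv xi1) rho;
  H4_lipschitz : forall r x y, 0 < r -> Wball r x -> Wball r y ->
    forall t, t \in `[zeta, t2] ->
      `|F t (x t) - F t (y t)| <= rho t * sup_norm (fun s => x s - y s) }.

(* The constant N is the supremum of this set. *)
Definition N_set (delta : R) : set R :=
  [set (t2 `^ ((alpha - xi) / (1 - xi)) - zeta `^ ((alpha - xi) / (1 - xi)))
         `^ (1 - xi) * ((1 - xi) / (alpha - xi)) `^ (1 - xi)
  | xi in [set xi | 0 <= xi < Num.min alpha delta]].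

End System.

(* Main.v *)
Require Import Defs.
From HB Require Import structures.
From mathcomp Require Import all_boot all_order all_algebra.
From mathcomp Require Import complex.
From mathcomp Require Import all_classical all_reals all_analysis.
From mathcomp Require Import measurable_realfun ess_sup_inf.
From mathcomp Require Import ring lra.

Set Implicit Arguments.
Unset Strict Implicit.
Unset Printing Implicit Defensive.

Import Order.TTheory GRing.Theory Num.Theory.
Import numFieldNormedType.Exports.

Local Open Scope classical_set_scope.
Local Open Scope ring_scope.

(** The mild solutions are the fixed points of
      (P x)(t) = Psi(t, zeta) x0 + int_zeta^t Psi(t, s) B u(s) s^(alpha - 1) ds
                 + int_zeta^t Psi(t, s) F(s, x(s)) s^(alpha - 1) ds
    on C([zeta, t2]; Z), and P is a contraction for the supremum norm.

    The condition (H4), applied to constant functions, says that F(t, .) is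
    rho(t)-Lipschitz ([H4_pointwise]). Hoelder's inequality with the exponents
    1 / xi1 and 1 / (1 - xi1) then bounds the distance of P x and P y by
    M M1 W |x - y|, where W, the norm of s^(alpha - 1) in L^(1 / (1 - xi1)), is
    one of the numbers of which N is the supremum ([weighted_integral_le]).

    That P is well defined and preserves continuity rests on the theory of the
    Bochner integral: a strongly measurable function of integrable norm is
    integrable ([is_bochner_exists]), the distance of two integrals is at most
    the integral of the distance ([is_bochner_dist_le]), and
    s |-> Psi(t, s) g(s) is strongly measurable with g
    ([strongly_measurable_operator]). For an integrand g such that
    s^(alpha - 1) |g(s)| is integrable, the Duhamel integral is continuous in t
    by dominated convergence ([duhamel_continuous]). This integrability follows
    for F(s, x(s)) from (H1) and Hoelder's inequality.

    For B u it needs care ([control_weight_integrable]). If alpha > 1/2, or if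
    zeta > 0, the weight is in L^2. Otherwise it is not, but then the existence
    of all the control integrals forces B = 0: for B b <> 0, the control
    s^(-1/2) (1 - ln s)^(-1) b is in L^2 near 0 and has divergent control
    integrals ([control_operator_eq0]). *)

(** * Linear maps and continuity on normed spaces *)

Lemma within_continuous_distP (R : realType) (V W : normedModType R) (S : set V)
    (f : V -> W) (p : V) : S p -> {within S, continuous f} ->
  forall e, 0 < e -> exists2 d, 0 < d &
    forall q, S q -> `|p - q| < d -> `|f p - f q| < e.
Proof.
move=> Sp cf e e0.
have /cvgrPdist_lt /(_ e e0) : f @ within S (nbhs p) --> f p.
  by have /subspace_continuousP := cf; apply.
rewrite /prop_near1 -nbhs_nbhs_norm => -[d /= d0 h].
by exists d => // q Sq pq; apply: h.
Qed.

Lemma linear_sum_scale (R : realType) (V W : normedModType R) (k : V -> W) :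
  linear k -> forall n (a : 'I_n -> R) (c : 'I_n -> V),
  k (\sum_(i < n) a i *: c i) = \sum_(i < n) a i *: k (c i).
Proof.
move=> lk n a c.
have k0 : k 0 = 0.
  by have := lk (-1) 0 0; rewrite scaler0 addr0 scaleN1r addNr.
by elim/big_rec2 : _ => // i y x _ <-; rewrite lk.
Qed.

Lemma linear_scale (R : realType) (V W : normedModType R) (k : V -> W) :
  linear k -> forall c x, k (c *: x) = c *: k x.
Proof.
move=> lk c x; have := linear_sum_scale lk (fun=> c) (fun _ : 'I_1 => x).
by rewrite !big_ord1.
Qed.

Lemma linear_sub (R : realType) (V W : normedModType R) (k : V -> W) :
  linear k -> forall x y, k (x - y) = k x - k y.
Proof.
by move=> lk x y; rewrite addrC -scaleN1r lk scaleN1r addrC.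
Qed.

Lemma bounded_linear_is_continuous (R : realType) (V W : normedModType R)
  (k : V -> W) : bounded_linear k -> continuous k.
Proof.
move=> [lk [C hC]] v; apply/cvgrPdist_lt => e e0.
have C0 : 0 < `|C| + 1 by rewrite ltr_wpDl.
near=> w; rewrite -linear_sub//; apply: le_lt_trans (hC _) _.
apply: (@le_lt_trans _ _ ((`|C| + 1) * `|v - w|)).
  by rewrite ler_wpM2r// (le_trans (ler_norm C))// lerDl.
rewrite mulrC -ltr_pdivlMr//; near: w.
by apply: cvgr_dist_lt; [exact: cvg_id|rewrite divr_gt0].
Unshelve. all: by end_near. Qed.

Lemma within_continuous_bounded (R : realType) (V : normedModType R) (a b : R)
    (x : R -> V) : a <= b -> {within `[a, b], continuous x} ->
  exists2 C, 0 < C & forall t, t \in `[a, b] -> `|x t| <= C.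
Proof.
move=> ab cx; have [|c _ hc] := @EVT_max R (fun t => `|x t|) a b ab.
  move=> t; apply: (@continuous_comp _ _ _ (x : subspace `[a, b] -> V)).
    exact: cx.
  exact: norm_continuous.
exists (`|x c| + 1); first by rewrite ltr_wpDl.
by move=> t tD; apply: le_trans (hc t tD) _; rewrite lerDl.
Qed.

(** * Integrals of nonnegative functions, up to null sets *)

Section LowerIntegral.
Context d (T : measurableType d) (R : realType).
Variable mu : {measure set T -> \bar R}.
Import HBNNSimple.
Local Open Scope ereal_scope.

(** The integral of a nonnegative function is the supremum of the integrals of
    the simple functions below it, and so is monotone and insensitive to null
    sets without any measurability assumption. *)
Lemma ge0_le_integral_ae (D : set T) (f g : T -> \bar R) : measurable D ->
  (forall x, D x -> 0 <= f x) -> (forall x, D x -> 0 <= g x) ->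
  {ae mu, forall x, D x -> f x <= g x} ->
  \int[mu]_(x in D) f x <= \int[mu]_(x in D) g x.
Proof.
move=> mD f0 g0 [N [mN N0 fgN]].
rewrite ge0_integralE// [leRHS]ge0_integralE//.
apply: ge_ereal_sup => _ /= [h hf <-].
have mNc := measurableC mN.
have -> : sintegral mu h = sintegral mu (proj_nnsfun h mNc).
  rewrite -!integralT_nnsfun; apply: ge0_ae_eq_integral => //.
  - by apply/measurable_EFinP.
  - exact/measurable_EFinP.
  - by move=> x _; rewrite lee_fin.
  - by move=> x _; rewrite lee_fin.
  exists N; split => // x /= hx; apply: contrapT => Nx; apply: hx => _.
  by rewrite mindicE mem_set//= mulr1.
apply: ereal_sup_ubound; exists (proj_nnsfun h mNc) => // x.
rewrite /= mindicE; case: (boolP (x \in ~` N)) => xN.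
  rewrite mulr1; apply: le_trans (hf x) _.
  rewrite !patchE; case: ifPn => // Dx.
  apply: contrapT => h2; move/set_mem: xN; apply; apply: fgN => /= h3.
  by apply: h2; apply: h3; exact: set_mem.
by rewrite mulr0; apply: erestrict_ge0.
Qed.

Lemma ge0_eq_integral_ae (D : set T) (f g : T -> \bar R) : measurable D ->
  (forall x, D x -> 0 <= f x) -> (forall x, D x -> 0 <= g x) ->
  {ae mu, forall x, D x -> f x = g x} ->
  \int[mu]_(x in D) f x = \int[mu]_(x in D) g x.
Proof.
move=> mD f0 g0 fg; apply/eqP; rewrite eq_le.
by apply/andP; split; apply: ge0_le_integral_ae => //;
  apply: filterS fg => x /[apply] ->.
Qed.

End LowerIntegral.

(** * Simple functions *)

Section SimpleFunctions.
Context {R : realType} {V : normedModType R}.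
Local Notation mu := (@lebesgue_measure R).
Local Notation T := (measurableTypeR R).

(** Any function of the values of a simple function is measurable, as these
    values are finitely many. *)
Lemma measurable_fun_simple_sum d' (Y : measurableType d') (phi : V -> Y) n
    (A : 'I_n -> set T) (c : 'I_n -> V) (v : V) :
  (forall i, measurable (A i)) ->
  measurable_fun [set: T]
    (fun t => phi (v + \sum_(i < n) (\1_(A i) t : R) *: c i)).
Proof.
elim: n A c v => [|n IHn] A c v mA.
  rewrite [X in measurable_fun _ X](_ : _ = cst (phi v)) //.
  by apply/funext => t; rewrite big_ord0 addr0.
rewrite [X in measurable_fun _ X](_ : _ = fun t => if t \in A ord0 then
    phi ((v + c ord0) + \sum_(i < n) (\1_(A (lift ord0 i)) t : R) *: c (lift ord0 i))
  else phi (v + \sum_(i < n) (\1_(A (lift ord0 i)) t : R) *: c (lift ord0 i))).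
  apply: measurable_fun_ifT => //.
  - by apply: (measurable_fun_bool true) => /=; rewrite preimage_mem_true setTI.
  - by apply: IHn.
  - by apply: IHn.
apply/funext => t; rewrite big_ord_recl indicE.
by case: ifP => _; rewrite ?scale1r ?scale0r ?add0r ?addrA.
Qed.

(** The sets A i may overlap: by induction on n, D is split along one of them,
    and the constant v accumulates the values of the sets met so far. *)
Lemma norm_simple_sum_le n (A : 'I_n -> set T) (c : 'I_n -> V) (D : set T)
    (v : V) :
  (forall i, measurable (A i)) -> measurable D -> (mu D < +oo)%E ->
  ((`|fine (mu D) *: v + \sum_(i < n) fine (mu (A i `&` D)) *: c i|)%:E
    <= \int[mu]_(t in D) (`|v + \sum_(i < n) (\1_(A i) t : R) *: c i|)%:E)%E.
Proof.
elim: n A c v D => [|n IHn] A c v D mA mD muD.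
  rewrite big_ord0 addr0 normrZ ger0_norm ?fine_ge0//.
  under eq_integral do rewrite big_ord0 addr0.
  rewrite integral_cst// EFinM muleC fineK//.
  by rewrite ge0_fin_numE.
have muS (E : set T) : measurable E -> E `<=` D -> (mu E < +oo)%E.
  by move=> mE ED; apply: le_lt_trans muD; apply: le_measure; rewrite ?inE.
pose E1 := A ord0 `&` D; pose E2 := D `\` A ord0.
have mE1 : measurable E1 by exact: measurableI.
have mE2 : measurable E2 by exact: measurableD.
have DE : D = E1 `|` E2 by rewrite /E1 /E2 setIC setUIDK.
have dE : E1 `&` E2 = set0.
  by rewrite -subset0 => t [[? ?] [? ?]].
have muE (B : set T) : measurable B ->
    fine (mu (B `&` D)) = fine (mu (B `&` E1)) + fine (mu (B `&` E2)).
  move=> mB; rewrite DE setIUr measureU ?fineD//.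
  - by rewrite ge0_fin_numE//; apply: muS; [exact: measurableI|move=> t [_ []]].
  - by rewrite ge0_fin_numE//; apply: muS; [exact: measurableI|move=> t [_ []]].
  - exact: measurableI.
  - exact: measurableI.
  - by rewrite setIACA setIid dE setI0.
have muDE : fine (mu D) = fine (mu E1) + fine (mu E2).
  by rewrite -[in LHS](setTI D) muE// !setTI.
rewrite DE ge0_integral_setU//; last 2 first.
  - apply/measurable_EFinP/measurable_funTS.
    exact: (@measurable_fun_simple_sum _ _ (fun w : V => `|w|)).
  - exact/disj_set2P.
rewrite -DE.
rewrite [X in (_ <= X + _)%E](@eq_integral _ _ _ _ _ (fun t => (`|(v + c ord0) +
    \sum_(i < n) (\1_(A (lift ord0 i)) t : R) *: c (lift ord0 i)|)%:E)); last first.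
  move=> t /set_mem [At _]; rewrite big_ord_recl indicE mem_set//.
  by rewrite scale1r addrA.
rewrite [X in (_ <= _ + X)%E](@eq_integral _ _ _ _ _ (fun t => (`|v +
    \sum_(i < n) (\1_(A (lift ord0 i)) t : R) *: c (lift ord0 i)|)%:E)); last first.
  move=> t /set_mem [_ At]; rewrite big_ord_recl indicE memNset//.
  by rewrite scale0r add0r.
apply: le_trans (leeD (IHn _ _ _ _ _ mE1 _) (IHn _ _ _ _ _ mE2 _)) => //; last 2 first.
  by apply: muS => // t [].
  by apply: muS => // t [].
rewrite -EFinD lee_fin; apply: le_trans (ler_normD _ _).
rewrite le_eqVlt; apply/orP; left; apply/eqP; congr (`|_|).
rewrite big_ord_recl muDE.
under eq_bigr do rewrite muE// scalerDl.
rewrite big_split /= scalerDl scalerDr -/E1.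
rewrite -!addrA; congr (_ + _).
rewrite addrC -!addrA; congr (_ + _).
by rewrite addrCA addrC -addrA; congr (_ + _).
Qed.

(** The restriction of a simple function to a measurable set. *)
Definition vs_restrict (A : set T) (mA : measurable A) (s : vsimple V) :
    vsimple V :=
  VSimple (vs_val (v := s)) (fun i => measurableI _ _ (vs_measurable (v := s) i) mA).

Lemma vs_restrictE A (mA : measurable A) s t :
  vs_restrict mA s t = (\1_A t : R) *: s t.
Proof.
rewrite /vsimple_fun scaler_sumr; apply: eq_bigr => i _ /=.
by rewrite scalerA indicI mulrC.
Qed.

(** The sets and values of the difference of two simple functions: those of
    the first, then those of the second with the values negated. *)
Definition vs_sub_set (s s' : vsimple V) (i : 'I_(vs_size s + vs_size s')) :
    set T :=
  match fintype.split i with inl j => vs_set j | inr j => vs_set j end.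

Definition vs_sub_val (s s' : vsimple V) (i : 'I_(vs_size s + vs_size s')) :
    V :=
  match fintype.split i with inl j => vs_val j | inr j => - vs_val j end.

Lemma vs_sub_measurable s s' i : measurable (@vs_sub_set s s' i).
Proof. by rewrite /vs_sub_set; case: fintype.split => j; exact: vs_measurable. Qed.

(** The difference of two simple functions, on the concatenation of their
    lists of sets. *)
Definition vs_sub (s s' : vsimple V) : vsimple V :=
  VSimple (@vs_sub_val s s') (@vs_sub_measurable s s').

Lemma vs_subE s s' t : vs_sub s s' t = s t - s' t.
Proof.
rewrite /vsimple_fun big_split_ord /= -sumrN; congr (_ + _).
  apply: eq_bigr => i _; rewrite /vs_sub_set /vs_sub_val.
  by rewrite (unsplitK (inl i)).
apply: eq_bigr => i _; rewrite /vs_sub_set /vs_sub_val.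
by rewrite (unsplitK (inr i)) scalerN.
Qed.

Lemma vsimple_int_sub D s s' :
  vsimple_int D (vs_sub s s') = vsimple_int D s - vsimple_int D s'.
Proof.
rewrite /vsimple_int big_split_ord /= -sumrN; congr (_ + _).
  apply: eq_bigr => i _; rewrite /vs_sub_set /vs_sub_val.
  by rewrite (unsplitK (inl i)).
apply: eq_bigr => i _; rewrite /vs_sub_set /vs_sub_val.
by rewrite (unsplitK (inr i)) scalerN.
Qed.

Lemma measurable_fun_vsimple d' (Y : measurableType d') (phi : V -> Y)
  (s : vsimple V) : measurable_fun [set: T] (fun t => phi (s t)).
Proof.
have := @measurable_fun_simple_sum _ _ phi _ _ (vs_val (v := s)) 0
  (vs_measurable (v := s)).
by congr (measurable_fun _ _); apply/funext => t; rewrite add0r.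
Qed.

Lemma norm_vsimple_int_le D (s : vsimple V) :
  measurable D -> (mu D < +oo)%E ->
  ((`|vsimple_int D s|)%:E <= \int[mu]_(t in D) (`|s t|)%:E)%E.
Proof.
move=> mD muD.
have := norm_simple_sum_le (vs_val (v := s)) 0 (vs_measurable (v := s)) mD muD.
rewrite scaler0 add0r => /le_trans; apply; rewrite le_eqVlt; apply/orP; left.
by apply/eqP/eq_integral => t _; rewrite add0r.
Qed.

End SimpleFunctions.

(** * Strong measurability *)

Section AlmostEverywhere. Context {R: realType}.
Local Notation mu := (@lebesgue_measure R).
Lemma ae_lebesgue_filter : Filter (nbhs (almost_everywhere mu)).
Proof. exact: (@ae_filter_ringOfSetsType _ (measurableTypeR R) _ mu). Qed.
End AlmostEverywhere.
#[global] Hint Extern 0 (Filter (nbhs (almost_everywhere _))) =>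
  (apply: ae_lebesgue_filter) : typeclass_instances.

Section StrongMeasurability.
Context {R : realType} {V : normedModType R}.
Local Notation mu := (@lebesgue_measure R).
Local Notation T := (measurableTypeR R).
Implicit Types (D : set T) (f g : R -> V).

Lemma strongly_measurable_ae_eq D f g :
  {ae mu, forall t, D t -> f t = g t} ->
  strongly_measurable D f -> strongly_measurable D g.
Proof.
move=> fg [s sf]; exists s; move: sf fg; rewrite /ae_approx.
apply: filterS2 => t h1 h2 Dt.
by rewrite -h2//; exact: h1.
Qed.

Lemma strongly_measurableS D E f :
  E `<=` D -> strongly_measurable D f -> strongly_measurable E f.
Proof.
move=> ED [s sf]; exists s; move: sf; rewrite /ae_approx.
by apply: filterS => t h /ED; exact: h.
Qed.

Lemma strongly_measurable_vsimple D (s : vsimple V) : strongly_measurable D s.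
Proof. by exists (fun=> s); apply: aeW => t _; exact: cvg_cst. Qed.

Lemma strongly_measurable_cst D (c : V) : strongly_measurable D (fun=> c).
Proof.
have := strongly_measurable_vsimple D (@VSimple R V 1 (fun=> setT) (fun=> c)
  (fun=> measurableT)).
apply: strongly_measurable_ae_eq; apply: aeW => t _.
by rewrite /vsimple_fun /= big_ord1 indicT scale1r.
Qed.

Lemma strongly_measurableB D f g :
  strongly_measurable D f -> strongly_measurable D g ->
  strongly_measurable D (fun t => f t - g t).
Proof.
move=> [s sf] [s' sg]; exists (fun n => vs_sub (s n) (s' n)).
move: sf sg; rewrite /ae_approx; apply: filterS2 => t h1 h2 Dt.
under eq_cvg do rewrite vs_subE.
by apply: cvgB; [exact: h1|exact: h2].
Qed.

(** A strongly measurable function on A, extended by 0, is strongly measurable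
    everywhere. *)
Lemma strongly_measurable_extend A D f : measurable A ->
  strongly_measurable A f ->
  strongly_measurable D (fun t => (\1_A t : R) *: f t).
Proof.
move=> mA [s sf]; exists (fun n => vs_restrict mA (s n)).
move: sf; rewrite /ae_approx; apply: filterS => t h Dt.
case: (boolP (t \in A)) => At.
  under eq_cvg do rewrite vs_restrictE indicE At scale1r.
  by rewrite indicE At scale1r; apply: h; exact: set_mem.
under eq_cvg do rewrite vs_restrictE indicE (negbTE At) scale0r.
by rewrite indicE (negbTE At) scale0r; exact: cvg_cst.
Qed.

(** The norm of a strongly measurable function agrees almost everywhere with a
    Borel function. *)
Lemma strongly_measurable_norm D f : measurable D -> strongly_measurable D f ->
  exists phi : R -> R, [/\ measurable_fun [set: T] phi, forall t, 0 <= phi t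
    & {ae mu, forall t, D t -> `|f t| = phi t}].
Proof.
move=> mD [s [N [mN N0 sfN]]].
have mE : measurable (D `\` N) by exact: measurableD.
exists (fun t => (\1_(D `\` N) t : R) * `|f t|); split.
- apply: (@measurable_fun_cvg _ _ _ _
    (fun n t => (\1_(D `\` N) t : R) * `|s n t|)) => //.
    move=> n; apply: measurable_funM; first exact: measurable_indic.
    exact: (measurable_fun_vsimple (fun w : V => `|w|)).
  move=> t _; rewrite indicE; case: (boolP (t \in D `\` N)) => DNt; last first.
    by rewrite mul0r; under eq_cvg do rewrite mul0r; exact: cvg_cst.
  apply: cvgMr; apply: cvg_norm.
  move/set_mem: DNt => [Dt Nt]; apply: contrapT => h; apply: Nt; apply: sfN.
  by move=> /= h'; apply: h; exact: h'.
- by move=> t; rewrite mulr_ge0// indicE.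
- exists N; split => // t /= h; apply: contrapT => Nt; apply: h => Dt.
  by rewrite indicE mem_set// mul1r.
Qed.

(** Scalars leave a weighted integral of the norm of a strongly measurable
    function. *)
Lemma ge0_integralZl_strongly D (w : R -> R) f (c : R) :
  measurable D -> strongly_measurable D f ->
  measurable_fun [set: T] w -> (forall t, 0 <= w t) -> 0 <= c ->
  (\int[mu]_(t in D) (c * (w t * `|f t|))%:E =
   c%:E * \int[mu]_(t in D) (w t * `|f t|)%:E)%E.
Proof.
move=> mD sf mw w0 c0.
have [phi [mphi phi0 fphi]] := strongly_measurable_norm mD sf.
rewrite [in RHS](@ge0_eq_integral_ae _ _ _ _ D _ (fun t => (w t * phi t)%:E))//;
  last 3 first.
- by move=> t _; rewrite lee_fin mulr_ge0.
- by move=> t _; rewrite lee_fin mulr_ge0.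
- by move: fphi; apply: filterS => t /[apply] ->.
rewrite -ge0_integralZl_EFin//; last 2 first.
- by move=> t _; rewrite lee_fin mulr_ge0.
- exact/measurable_EFinP/measurable_funTS/measurable_funM.
apply: ge0_eq_integral_ae => //.
- by move=> t _; rewrite lee_fin !mulr_ge0.
- by move=> t _; rewrite -EFinM lee_fin !mulr_ge0.
- by move: fphi; apply: filterS => t /[apply] ->.
Qed.

Lemma le_integral_normB D f g : measurable D ->
  strongly_measurable D f -> strongly_measurable D g ->
  (\int[mu]_(t in D) (`|f t - g t|)%:E <=
   \int[mu]_(t in D) (`|f t|)%:E + \int[mu]_(t in D) (`|g t|)%:E)%E.
Proof.
move=> mD sf sg.
have [phi [mphi phi0 fphi]] := strongly_measurable_norm mD sf.
have [psi [mpsi psi0 gpsi]] := strongly_measurable_norm mD sg.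
have -> : (\int[mu]_(t in D) (`|f t|)%:E = \int[mu]_(t in D) (phi t)%:E)%E.
  apply: ge0_eq_integral_ae => //; first by move=> t _; rewrite lee_fin.
  by move: fphi; apply: filterS => t /[apply] ->.
have -> : (\int[mu]_(t in D) (`|g t|)%:E = \int[mu]_(t in D) (psi t)%:E)%E.
  apply: ge0_eq_integral_ae => //; first by move=> t _; rewrite lee_fin.
  by move: gpsi; apply: filterS => t /[apply] ->.
rewrite -ge0_integralD//; last 4 first.
- by move=> t _; rewrite lee_fin.
- exact/measurable_EFinP/measurable_funTS.
- by move=> t _; rewrite lee_fin.
- exact/measurable_EFinP/measurable_funTS.
apply: ge0_le_integral_ae => //.
  by move=> t _; rewrite -EFinD lee_fin addr_ge0.
move: fphi gpsi; apply: filterS2 => t h1 h2 Dt.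
by rewrite -EFinD lee_fin -h1// -h2//; exact: ler_normB.
Qed.

(** Dominated convergence to 0 for strongly measurable functions. *)
Lemma dominated_cvg0_strongly D (f : nat -> R -> V) (g : R -> R) :
  measurable D -> (forall n, strongly_measurable D (f n)) ->
  measurable_fun [set: T] g -> (\int[mu]_(t in D) (g t)%:E < +oo)%E ->
  {ae mu, forall t, D t -> forall n, `|f n t| <= g t} ->
  {ae mu, forall t, D t -> f n t @[n --> \oo] --> (0 : V)} ->
  (\int[mu]_(t in D) (`|f n t|)%:E @[n --> \oo] --> 0)%E.
Proof.
move=> mD sf mg ig fg f0.
have /choice [phi phiP] n := strongly_measurable_norm mD (sf n).
have mphi n : measurable_fun [set: T] (phi n) by have [] := phiP n.
have phi0 n t : 0 <= phi n t by have [] := phiP n.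
have fphi : {ae mu, forall t, D t -> forall n, `|f n t| = phi n t}.
  have : {ae mu, forall t n, D t -> `|f n t| = phi n t}.
    by apply/ae_foralln => n; have [] := phiP n.
  by apply: filterS => t h Dt n; exact: h.
under eq_cvg => n.
  rewrite (_ : (\int[mu]_(t in D) (`|f n t|)%:E)%E =
               (\int[mu]_(t in D) (phi n t)%:E)%E); last first.
    apply: ge0_eq_integral_ae => //; first by move=> t _; rewrite lee_fin.
    by move: fphi; apply: filterS => t h Dt; rewrite h.
  over.
have gmax : {ae mu, forall t, D t -> g t = Num.max (g t) 0}.
  move: fg; apply: filterS => t h Dt; apply/esym/max_idPl.
  by apply: le_trans (h Dt 0%N).
pose g' t := Num.max (g t) 0.
have mg' : measurable_fun [set: T] g'.
  by apply: measurable_maxr => //; exact: measurable_cst.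
have g'0 t : 0 <= g' t by rewrite le_max lexx orbT.
have ig' : mu.-integrable D (EFin \o g').
  apply/integrableP; split; first exact/measurable_EFinP/measurable_funTS.
  apply: le_lt_trans ig; rewrite le_eqVlt; apply/orP; left; apply/eqP.
  apply: ae_eq_integral => //.
  - by apply: measurableT_comp => //; exact/measurable_EFinP/measurable_funTS.
  - exact/measurable_EFinP/measurable_funTS.
  - move: gmax; apply: filterS => t h Dt /=.
    by rewrite ger0_norm// h.
have := @dominated_convergence _ _ _ mu D mD (fun n => EFin \o phi n)
  (cst 0%E) (EFin \o g') (fun n => (measurable_EFinP _ _).2
  (measurable_funTS (mphi n))) (measurable_cst _).
case=> //.
- move: fphi f0; apply: filterS2 => t h1 h2 Dt /=.
  apply: cvg_EFin; first exact: nearW.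
  rewrite [X in X @ _ --> _](_ : _ = fun n => `|f n t|); last first.
    by apply/funext => n /=; rewrite h1.
  by rewrite -(@normr0 _ V); apply: cvg_norm; exact: h2.
- move: fphi fg; apply: filterS2 => t h1 h2 n Dt /=.
  rewrite lee_fin ger0_norm// -h1// le_max.
  by rewrite (h2 Dt n).
- by move=> _ _; rewrite integral0.
Qed.

End StrongMeasurability.

Section OperatorFamily.
Context {R : realType} {V W : normedModType R}.
Local Notation mu := (@lebesgue_measure R).
Local Notation T := (measurableTypeR R).

(** A simple function given by sets and values indexed by a finite type. *)
Definition vs_of_fin (I : finType) (A : I -> set T)
    (mA : forall i, measurable (A i)) (c : I -> W) : vsimple W :=
  VSimple (fun i : 'I_#|I| => c (enum_val i)) (fun i => mA (enum_val i)).

Lemma vs_of_finE (I : finType) (A : I -> set T) mA c t :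
  @vs_of_fin I A mA c t = \sum_i (\1_(A i) t : R) *: c i.
Proof.
by rewrite (big_enum_val (fun i => (\1_(A i) t : R) *: c i)).
Qed.

Variables (a b : R).
Hypothesis ab : a < b.

Let h n : R := (b - a) / n.+1%:R.
Let node n (j : nat) : R := a + j%:R * h n.
Let cell n j : set T := `[node n j, node n j.+1[%classic.

Let h_gt0 n : 0 < h n.
Proof. by rewrite divr_gt0// subr_gt0. Qed.

Let cell_unique n j k t : cell n j t -> cell n k t -> j = k.
Proof.
rewrite /cell /= !in_itv /= => /andP[j1 j2] /andP[k1 k2].
have := le_lt_trans j1 k2; have := le_lt_trans k1 j2.
rewrite /node !ltrD2l !ltr_pM2r// !ltr_nat !ltnS => kj jk.
by apply/eqP; rewrite eqn_leq jk kj.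
Qed.

Let cell_exists n t : a <= t < b -> exists j : 'I_n.+1, cell n j t.
Proof.
move=> /andP[at_ tb].
have u0 : 0 <= (t - a) / h n by rewrite divr_ge0 ?subr_ge0// ltW.
have /andP[h1 h2] := truncn_itv u0.
have jn : (Num.truncn ((t - a) / h n) < n.+1)%N.
  rewrite ltnS truncn_le_nat ltr_pdivrMr//.
  by rewrite /h mulrC divfK ?pnatr_eq0// ltrD2r.
exists (Ordinal jn); rewrite /cell /= in_itv /= /node.
move: h1 h2; rewrite ler_pdivlMr// ltr_pdivrMr// => h1 h2.
by rewrite -lerBrDl h1 -ltrBlDl h2.
Qed.

Let measurable_grid n m (A : 'I_m -> set T) (mA : forall i, measurable (A i))
  (p : 'I_n.+1 * 'I_m) : measurable (cell n p.1 `&` A p.2).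
Proof. by apply: measurableI => //; exact: measurable_itv. Qed.

(** If k s is linear for s in (a, b) and (s, v) |-> k s v is continuous on
    (a, b) * V, then s |-> k s (f s) is strongly measurable with f: freeze the
    first argument of k on the cells of finer and finer grids, and replace f by
    simple functions. *)
Lemma strongly_measurable_operator (k : R -> V -> W) (f : R -> V) :
  (forall s, a < s < b -> linear (k s)) ->
  (forall s v, a < s < b -> {for (s, v), continuous (fun p => k p.1 p.2)}) ->
  strongly_measurable `[a, b] f ->
  strongly_measurable `[a, b] (fun s => k s (f s)).
Proof.
move=> lk ck [g gf].
exists (fun n => vs_of_fin (@measurable_grid n _ _ (vs_measurable (v := g n)))
  (fun p => k (node n p.1) (vs_val (v := g n) p.2))).
have ab0 : {ae mu, forall t : R, t != a /\ t != b}.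
  exists [set a; b]; split.
  - by apply: measurableU; exact: measurable_set1.
  - by rewrite null_set_setU//; exact: lebesgue_measure_set1.
  - move=> t /= /not_andP[] /negP; rewrite negbK => /eqP ->; [by left|by right].
move: gf ab0; rewrite /ae_approx; apply: filterS2 => t gf [ta tb] /[dup] Dt.
rewrite /= in_itv /= => /andP[at_ tb'].
have {}at_ : a < t by rewrite lt_neqAle eq_sym ta.
have {}tb' : t < b by rewrite lt_neqAle tb.
have jex n : exists j : 'I_n.+1, cell n j t.
  by apply: cell_exists; rewrite ltW.
pose j n : 'I_n.+1 := projT1 (cid (jex n)).
have jP n : cell n (j n) t := projT2 (cid (jex n)).
have nodet n : node n (j n) <= t < node n (j n) + h n.
  have := jP n; rewrite /cell /= in_itv /= /node => /andP[-> /=].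
  by rewrite -natr1 mulrDl mul1r addrA.
have h0 : h n @[n --> \oo] --> 0.
  by rewrite -(mulr0 (b - a)); apply: cvgMr; exact: cvg_harmonic.
have nodecvg : node n (j n) @[n --> \oo] --> t.
  apply/cvgrPdist_le => /= e e0; near=> n.
  have /andP[h1 h2] := nodet n.
  rewrite ger0_norm ?subr_ge0// lerBlDl; apply: le_trans (ltW h2) _.
  rewrite lerD2l; apply: le_trans (ler_norm _) _.
  by rewrite -normrN -sub0r; near: n; exact: cvgr_dist_le.
have kcvg : k (node n (j n)) (g n t) @[n --> \oo] --> k t (f t).
  have := ck t (f t); rewrite at_ tb' => /(_ isT) ckt.
  have pcvg : (node n (j n), g n t) @[n --> \oo] --> (t, f t).
    exact: cvg_pair nodecvg (gf Dt).
  exact: (cvg_comp _ _ pcvg ckt).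
apply: cvg_trans kcvg; apply: near_eq_cvg; near=> n.
have an : a < node n (j n).
  by near: n; exact: (cvgr_gt t nodecvg).
have linn : linear (k (node n (j n))).
  apply: lk; rewrite an /=; apply: le_lt_trans tb'.
  by have /andP[] := nodet n.
rewrite vs_of_finE {1}/vsimple_fun linear_sum_scale//.
rewrite (bigID (fun p : 'I_n.+1 * 'I_(vs_size (g n)) => p.1 == j n)) /=.
rewrite [X in _ = _ + X]big1 ?addr0; last first.
  move=> p /eqP pj; rewrite indicE memNset ?scale0r// => -[cp _].
  by apply: pj; apply: val_inj; exact: (cell_unique cp (jP n)).
rewrite (eq_bigl (fun p : 'I_n.+1 * 'I_(vs_size (g n)) =>
  (p.1 == j n) && true)); last first.
  by move=> p; rewrite andbT.
rewrite -(pair_big (fun i => i == j n) (fun=> true) (fun i l =>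
  (\1_(cell n i `&` vs_set l) t : R) *: k (node n i) (vs_val l))) /=.
rewrite big_pred1_eq; apply: eq_bigr => l _.
by rewrite indicI /= [\1_(cell _ _) t]indicE mem_set// mul1r.
Unshelve. all: by end_near. Qed.

End OperatorFamily.

(** * The Bochner integral *)

Section BochnerIntegral.
Context {R : realType} {V : normedModType R}.
Local Notation mu := (@lebesgue_measure R).
Local Notation T := (measurableTypeR R).
Implicit Types (D : set T) (f g : R -> V).

Lemma is_bochner_strongly_measurable D f v :
  is_bochner D f v -> strongly_measurable D f.
Proof. by move=> [s [sf _ _]]; exists s. Qed.

Lemma le_integral_norm_triangle D f g h : measurable D ->
  strongly_measurable D f -> strongly_measurable D g ->
  strongly_measurable D h ->
  (\int[mu]_(t in D) (`|f t - h t|)%:E <= \int[mu]_(t in D) (`|f t - g t|)%:E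
    + \int[mu]_(t in D) (`|g t - h t|)%:E)%E.
Proof.
move=> mD sf sg sh.
have := le_integral_normB mD (strongly_measurableB sf sg)
  (strongly_measurableB sh sg).
under eq_integral do rewrite opprB addrA subrK.
by under [X in (_ <= _ + X)%E -> _]eq_integral do rewrite distrC.
Qed.

Lemma near_lt_ereal_cvg0 (x : nat -> \bar R) (e : R) : 0 < e ->
  x @ \oo --> 0%E -> \forall n \near \oo, (x n < e%:E)%E.
Proof.
move=> e0 x0; apply: (x0 [set y | (y < e%:E)%E]).
by apply: open_nbhs_nbhs; split; [exact: open_ereal_lt_ereal|rewrite /= lte_fin].
Qed.

Lemma integral_norm_vsimple_lty D (s : vsimple V) :
  measurable D -> (mu D < +oo)%E -> (\int[mu]_(t in D) (`|s t|)%:E < +oo)%E.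
Proof.
move=> mD muD; pose c := \sum_(i < vs_size s) `|vs_val i|.
have c0 : 0 <= c by exact: sumr_ge0.
apply: (@le_lt_trans _ _ (\int[mu]_(t in D) (cst c%:E t))%E).
  apply: ge0_le_integral_ae => //.
  apply: aeW => t _; rewrite lee_fin; apply: le_trans (ler_norm_sum _ _ _) _.
  apply: ler_sum => i _; rewrite normrZ ger0_norm ?indicE//.
  by apply: ler_piMl => //; case: (_ \in _); rewrite ?lexx ?ler01.
by rewrite integral_cst//; apply: lte_mul_pinfty; rewrite ?lee_fin.
Qed.

Lemma is_bochner_integral_norm_lty D f v : measurable D -> (mu D < +oo)%E ->
  is_bochner D f v -> (\int[mu]_(t in D) (`|f t|)%:E < +oo)%E.
Proof.
move=> mD muD [s [sf fs _]].
have [n nlt] : exists n, (\int[mu]_(t in D) (`|f t - s n t|)%:E < 1)%E.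
  have : \forall n \near \oo, (\int[mu]_(t in D) (`|f t - s n t|)%:E < 1)%E.
    exact: near_lt_ereal_cvg0 fs.
  by move=> [n _ /(_ n (leqnn n)) h]; exists n.
have sfs : strongly_measurable D (fun t => f t - s n t).
  by apply: strongly_measurableB; [exists s|exact: strongly_measurable_vsimple].
have sms : strongly_measurable D (fun t => - s n t).
  have := strongly_measurableB (strongly_measurable_vsimple D (vs_sub (s n) (s n)))
    (strongly_measurable_vsimple D (s n)).
  by apply: strongly_measurable_ae_eq; apply: aeW => t _; rewrite vs_subE subrr sub0r.
have := le_integral_normB mD sfs sms.
under eq_integral do rewrite opprK subrK.
move=> /le_lt_trans; apply; apply: lte_add_pinfty.
  by apply: lt_trans nlt _; rewrite ltry.
under eq_integral do rewrite normrN.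
exact: integral_norm_vsimple_lty.
Qed.

(** The fundamental estimate; in particular the Bochner integral is unique. *)
Lemma is_bochner_dist_le D f g v w : measurable D -> (mu D < +oo)%E ->
  is_bochner D f v -> is_bochner D g w ->
  ((`|v - w|)%:E <= \int[mu]_(t in D) (`|f t - g t|)%:E)%E.
Proof.
move=> mD muD [s [sf fs vs]] [r [rg gr wr]].
have smf : strongly_measurable D f by exists s.
have smg : strongly_measurable D g by exists r.
have sms n := strongly_measurable_vsimple D (s n).
have smr n := strongly_measurable_vsimple D (r n).
set I := (\int[mu]_(t in D) (`|f t - g t|)%:E)%E.
have I0 : (0 <= I)%E by apply: integral_ge0 => t _; rewrite lee_fin.
have [Ioo|Ifin] := eqVneq I +oo%E; first by rewrite Ioo leey.
have bound n : ((`|vsimple_int D (s n) - vsimple_int D (r n)|)%:E <=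
    \int[mu]_(t in D) (`|f t - s n t|)%:E + I + \int[mu]_(t in D) (`|g t - r n t|)%:E)%E.
  rewrite -vsimple_int_sub; apply: le_trans (norm_vsimple_int_le _ mD muD) _.
  under eq_integral do rewrite vs_subE.
  apply: le_trans (le_integral_norm_triangle mD (sms n) smf (smr n)) _.
  under eq_integral do rewrite distrC.
  rewrite -addeA leeD2l//.
  exact: le_integral_norm_triangle mD smf smg (smr n).
have : (fun n => (`|vsimple_int D (s n) - vsimple_int D (r n)|)%:E) @ \oo
    --> (`|v - w|)%:E.
  by apply: cvg_EFin; [exact: nearW|apply: cvg_norm; exact: cvgB].
move=> cl.
have cr : (fun n => (\int[mu]_(t in D) (`|f t - s n t|)%:E + I +
    \int[mu]_(t in D) (`|g t - r n t|)%:E)%E) @ \oo --> I.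
  rewrite -[X in _ --> X]adde0 -[X in _ --> (X + _)%E]add0e.
  apply: cvgeD => //; first by rewrite add0e fin_num_adde_defl.
  by apply: cvgeD; [rewrite fin_num_adde_defr|exact: fs|exact: cvg_cst].
rewrite -(cvg_lim _ cl)// -(cvg_lim _ cr)//; apply: lee_lim; last exact: nearW.
  by apply/cvg_ex; eexists; exact: cl.
by apply/cvg_ex; eexists; exact: cr.
Qed.

Lemma is_bochner_unique D f v w : measurable D -> (mu D < +oo)%E ->
  is_bochner D f v -> is_bochner D f w -> v = w.
Proof.
move=> mD muD hv hw; have := is_bochner_dist_le mD muD hv hw.
under eq_integral do rewrite subrr normr0.
rewrite integral0 lee_fin normr_le0 subr_eq0.
exact: eqP.
Qed.

(** A Bochner integral over A is the integral over any larger set of the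
    function extended by 0. *)
Lemma is_bochner_extend A D f v : measurable A -> measurable D -> A `<=` D ->
  is_bochner A f v -> is_bochner D (fun t => (\1_A t : R) *: f t) v.
Proof.
move=> mA mD AD [s [sf fs vs]].
exists (fun n => vs_restrict mA (s n)); split.
- move: sf; rewrite /ae_approx; apply: filterS => t h Dt.
  case: (boolP (t \in A)) => At.
    under eq_cvg do rewrite vs_restrictE indicE At scale1r.
    by rewrite indicE At scale1r; apply: h; exact: set_mem.
  under eq_cvg do rewrite vs_restrictE indicE (negbTE At) scale0r.
  by rewrite indicE (negbTE At) scale0r; exact: cvg_cst.
- apply: cvg_trans fs; apply: near_eq_cvg; apply: nearW => n.
  rewrite integral_mkcond [RHS]integral_mkcond; apply: eq_integral => t _.
  rewrite !patchE vs_restrictE -scalerBr indicE.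
  case: (boolP (t \in A)) => At.
    by rewrite mem_set ?scale1r//; apply: AD; exact: set_mem.
  by rewrite scale0r normr0; case: ifP.
- apply: cvg_trans vs; apply: near_eq_cvg; apply: nearW => n.
  apply: eq_bigr => i _ /=; congr (fine (mu _) *: _).
  by rewrite -setIA; congr (_ `&` _); apply/esym/setIidl.
Qed.

End BochnerIntegral.

(** Bochner's criterion: over a set of finite measure and in a complete space,
    a strongly measurable function of integrable norm is Bochner integrable. *)
Lemma is_bochner_exists (R : realType) (V : completeNormedModType R)
    (D : set (measurableTypeR R)) (f : R -> V) :
  measurable D -> (lebesgue_measure D < +oo)%E -> strongly_measurable D f ->
  (\int[lebesgue_measure]_(t in D) (`|f t|)%:E < +oo)%E ->
  exists v, is_bochner D f v.
Proof.
move=> mD muD sf fint; set mu := @lebesgue_measure R.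
have [phi [mphi phi0 fphi]] := strongly_measurable_norm mD sf.
have [s sfs] := sf.
(* Truncating s n where its norm exceeds 2|f| makes it dominated. *)
pose E n : set (measurableTypeR R) := [set t | `|s n t| <= 2 * phi t].
have mE n : measurable (E n).
  rewrite -[E n]setTI; apply: measurable_fun_le => //.
    exact: (measurable_fun_vsimple (fun w : V => `|w|)).
  by apply: measurable_funM.
pose s' n := vs_restrict (mE n) (s n).
have s'f : ae_approx D f s'.
  move: sfs fphi; rewrite /ae_approx; apply: filterS2 => t h1 h2 Dt.
  have [ft0|ft0] := eqVneq (f t) 0.
    rewrite ft0; under eq_cvg => n.
      rewrite vs_restrictE (_ : _ *: _ = 0); last first.
        rewrite indicE; case: (boolP (t \in E n)) => [|_]; last by rewrite scale0r.
        move/set_mem; rewrite /E /= -h2// ft0 normr0 mulr0 normr_le0 => /eqP ->.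
        by rewrite scaler0.
      over.
    exact: cvg_cst.
  have h3 : \forall n \near \oo, `|s n t| < 2 * `|f t|.
    apply: (cvgr_lt (`|f t|)); first by apply: cvg_norm; exact: h1.
    by rewrite mulr_natl mulr2n ltrDl normr_gt0.
  apply: cvg_trans (h1 Dt); apply: near_eq_cvg; near=> n.
  rewrite vs_restrictE indicE mem_set ?scale1r// /E /= -h2//.
  by apply: ltW; near: n.
have s'le n t : `|s' n t| <= 2 * phi t.
  rewrite vs_restrictE indicE; case: (boolP (t \in E n)) => [/set_mem|_].
    by rewrite scale1r.
  by rewrite scale0r normr0 mulr_ge0.
have fs' : (\int[mu]_(t in D) (`|f t - s' n t|)%:E @[n --> \oo] --> 0)%E.
  apply: (@dominated_cvg0_strongly _ _ D (fun n t => f t - s' n t)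
    (fun t => 3 * phi t)) => //.
  - move=> n; apply: strongly_measurableB => //.
    exact: strongly_measurable_vsimple.
  - exact: measurable_funM.
  - under eq_integral do rewrite EFinM.
    rewrite ge0_integralZl_EFin//; last 2 first.
      by move=> t _; rewrite lee_fin.
      exact/measurable_EFinP/measurable_funTS.
    apply: lte_mul_pinfty => //.
    rewrite (_ : \int[_]_(t in D) _ = \int[mu]_(t in D) (`|f t|)%:E)%E//.
    apply: ge0_eq_integral_ae => //; first by move=> t _; rewrite lee_fin.
    by move: fphi; apply: filterS => t /[apply] ->.
  - move: fphi; apply: filterS => t h Dt n.
    apply: le_trans (ler_normB _ _) _; rewrite h//.
    have := s'le n t; lra.
  - move: s'f; rewrite /ae_approx; apply: filterS => t h Dt.
    rewrite -(subrr (f t)); apply: cvgB; [exact: cvg_cst|exact: h].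
have : cvg (vsimple_int D (s' n) @[n --> \oo]).
  apply/cauchy_cvgP/cauchy_exP => e e0.
  have e20 : 0 < e / 2 by rewrite divr_gt0.
  have : \forall n \near \oo, (\int[mu]_(t in D) (`|f t - s' n t|)%:E < (e / 2)%:E)%E.
    exact: near_lt_ereal_cvg0 fs'.
  move=> [N _ hN]; exists (vsimple_int D (s' N)); exists N => // m /= Nm.
  rewrite -ball_normE /ball_ /= -vsimple_int_sub -lte_fin.
  apply: le_lt_trans (norm_vsimple_int_le _ mD muD) _.
  under eq_integral do rewrite vs_subE.
  have sms' n : strongly_measurable D (s' n) by exact: strongly_measurable_vsimple.
  apply: le_lt_trans (le_integral_norm_triangle mD (sms' N) sf (sms' m)) _.
  under eq_integral do rewrite distrC.
  rewrite [ltRHS](_ : _ = (e / 2)%:E + (e / 2)%:E)%E; last by rewrite -EFinD -splitr.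
  by apply: lteD; apply: hN => //=.
move=> /cvg_ex[v vv]; exists v; exists s'; split => //.
Unshelve. all: by end_near. Qed.

(** * The weight s^(alpha - 1) and Hoelder's inequality *)

Section ImproperFTC.
Context {R : realType}.
Local Notation mu := (@lebesgue_measure R).
Variables (f F : R -> R) (a b : R).
Hypothesis cf : forall x, a < x -> x <= b -> {for x, continuous f}.
Hypothesis dF : forall x, a < x -> x <= b -> is_derive x 1 F (f x).

Lemma FTC2_subinterval c : a < c -> c < b ->
  (\int[mu]_(x in `[c, b]) (f x)%:E = (F b)%:E - (F c)%:E)%E.
Proof.
move=> ac cb.
have cF x : a < x -> x <= b -> {for x, continuous F}.
  move=> ax xb; apply/differentiable_continuous/derivable1_diffP.
  by have [] := dF ax xb.
apply: continuous_FTC2 => //.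
- apply: continuous_in_subspaceT => x /set_mem; rewrite /= in_itv /= => /andP[cx xb].
  by apply: cf => //; exact: lt_le_trans cx.
- split.
  + move=> x; rewrite in_itv /= => /andP[cx xb].
    by have [] := dF (lt_trans ac cx) (ltW xb).
  + by apply: cvg_at_right_filter; apply: cF => //; exact: ltW.
  + by apply: cvg_at_left_filter; apply: cF => //; exact: lt_trans cb.
- move=> x; rewrite in_itv /= => /andP[cx xb].
  have [dFx <-] := dF (lt_trans ac cx) (ltW xb).
  exact: derive1E.
Qed.

Hypothesis ab : a < b.

Lemma measurable_fun_continuous_oc : measurable_fun `]a, b] f.
Proof.
apply: subspace_continuous_measurable_fun; first exact: measurable_itv.
apply: continuous_in_subspaceT => x /set_mem; rewrite /= in_itv /= => /andP[ax xb].
exact: cf.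
Qed.

(** The fundamental theorem of calculus for a nonnegative function that may be
    singular at the left end of the interval. *)
Lemma ge0_improper_FTC2 l : (forall x, a < x -> x <= b -> 0 <= f x) ->
  F x @[x --> a^'+] --> l ->
  (\int[mu]_(x in `[a, b]) (f x)%:E = (F b - l)%:E)%E.
Proof.
move=> f0 Fl.
pose c n : R := a + (b - a) / n.+2%:R.
have ba0 : 0 < b - a by rewrite subr_gt0.
have ac n : a < c n by rewrite ltrDl divr_gt0.
have cb n : c n < b.
  by rewrite /c -ltrBrDl ltr_pdivrMr// ltr_pMr// ltr1n.
have c_ni m n : (m <= n)%N -> c n <= c m.
  move=> mn; rewrite lerD2l ler_pM2l// lef_pV2 ?posrE//.
  by rewrite ler_nat !ltnS.
have ca : c n @[n --> \oo] --> a.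
  rewrite -[X in _ --> X]addr0; apply: cvgD; first exact: cvg_cst.
  rewrite -(mulr0 (b - a)); apply: cvgMr.
  by have := @cvg_harmonic R; rewrite -(cvg_shiftS (@harmonic R)).
pose D n : set (measurableTypeR R) := `[c n, b]%classic.
have DU : \bigcup_n D n = `]a, b]%classic.
  apply/seteqP; split => x /=.
    move=> [n _]; rewrite /D /= !in_itv /= => /andP[h ->].
    by rewrite (lt_le_trans (ac n) h).
  rewrite in_itv /= => /andP[ax xb].
  have : \forall n \near \oo, c n < x by apply: (cvgr_lt a).
  move=> [n _ /(_ n (leqnn n)) h]; exists n => //.
  by rewrite /D /= in_itv /= xb andbT ltW.
have mf : measurable_fun `]a, b] (EFin \o f).
  by apply/measurable_EFinP; exact: measurable_fun_continuous_oc.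
rewrite -integral_itv_obnd_cbnd// -DU.
have c1 : (\int[mu]_(x in D n) (f x)%:E)%E @[n --> \oo] -->
    (\int[mu]_(x in \bigcup_n D n) (f x)%:E)%E.
  apply: (@ge0_nondecreasing_set_cvg_integral _ _ _ D (EFin \o f) mu).
  - apply/nondecreasing_seqP => n; rewrite subsetEset /D => x /=.
    rewrite !in_itv /= => /andP[h ->]; rewrite andbT; apply: le_trans h.
    exact: c_ni.
  - by move=> n; exact: measurable_itv.
  - move=> n; apply: measurable_funS mf => //.
    by rewrite -DU => x Dx; exists n.
  - move=> n x; rewrite /D /= in_itv /= lee_fin => /andP[h1 h2].
    by apply: f0 => //; exact: lt_le_trans h1.
have c2 : (\int[mu]_(x in D n) (f x)%:E)%E @[n --> \oo] --> (F b - l)%:E.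
  under eq_cvg do rewrite (FTC2_subinterval (ac _) (cb _)) -EFinB.
  apply: cvg_EFin; first exact: nearW.
  apply: cvgB; first exact: cvg_cst.
  by have /cvg_at_rightP := Fl; apply; split.
exact: (cvg_unique _ c1 c2).
Qed.

End ImproperFTC.

Lemma continuous_powR (R : realType) (q x : R) :
  0 < x -> {for x, continuous (fun s : R => s `^ q)}.
Proof.
move=> x0; apply/differentiable_continuous/derivable1_diffP.
by have [] := is_derive1_powR q x0.
Qed.

Lemma integral_powR (R : realType) (a b p : R) : 0 <= a -> a < b -> 0 < p ->
  (\int[lebesgue_measure]_(s in `[a, b]) (s `^ (p - 1))%:E
    = ((b `^ p - a `^ p) / p)%:E)%E.
Proof.
move=> a0 ab p0.
rewrite (@ge0_improper_FTC2 _ _ (fun s => s `^ p / p) _ _ _ _ _ (a `^ p / p))//.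
- by rewrite mulrBl.
- by move=> x ax _; apply: continuous_powR; exact: le_lt_trans ax.
- move=> x ax _.
  have x0 : 0 < x by exact: le_lt_trans ax.
  have h := is_derive1_powR p x0.
  have := @is_deriveZ _ _ _ _ p^-1 x 1 _ h.
  rewrite (_ : p^-1 *: (p * x `^ (p - 1)) = x `^ (p - 1)); last first.
    by rewrite /GRing.scale /= mulKf// gt_eqF.
  rewrite (_ : (fun s => s `^ p / p) = (p^-1 \*: (fun s : R => s `^ p)))//.
  by apply/funext => s; rewrite mulrC.
- by move=> x _ _; exact: powR_ge0.
- apply: cvgMl; move: a0; rewrite le_eqVlt => /predU1P[<-|a0].
    by rewrite powR0 ?gt_eqF//; exact: powR_cvg0.
  exact/cvg_at_right_filter/continuous_powR.
Qed.

Section WeightedHoelder.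
Context {R : realType} {V : normedModType R}.
Local Notation mu := (@lebesgue_measure R).
Local Notation T := (measurableTypeR R).

(** For 0 <= a < b and 0 <= xi < alpha <= 1, the norm of s^(alpha - 1) in
    L^(1 / (1 - xi)) over [a, b]. *)
Definition weight_norm (alpha a b xi : R) : R :=
  (b `^ ((alpha - xi) / (1 - xi)) - a `^ ((alpha - xi) / (1 - xi)))
    `^ (1 - xi) * ((1 - xi) / (alpha - xi)) `^ (1 - xi).

Lemma weight_norm_ge0 alpha a b xi : 0 <= weight_norm alpha a b xi.
Proof. by rewrite mulr_ge0// powR_ge0. Qed.

Variables (alpha a b : R) (f : R -> V).
Hypotheses (a0 : 0 <= a) (ab : a < b) (alpha1 : alpha <= 1).
Local Notation D := (`[a, b]%classic : set T).
Hypothesis sf : strongly_measurable D f.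

Let mD : measurable D. Proof. exact: measurable_itv. Qed.

Let pow_incr p : 0 < p -> a `^ p <= b `^ p.
Proof.
move=> p0; apply: ge0_ler_powR; rewrite ?nnegrE ?(ltW p0) ?(ltW ab)//.
exact: le_trans (ltW ab).
Qed.

Lemma weighted_integral_le_infty : 0 < alpha ->
  (\int[mu]_(s in D) (s `^ (alpha - 1) * `|f s|)%:E <=
    Lp_norm D +oo f * (weight_norm alpha a b 0)%:E)%E.
Proof.
move=> alpha0; rewrite /weight_norm !subr0 !divr1 div1r.
have dpow0 : 0 <= b `^ alpha - a `^ alpha by rewrite subr_ge0 pow_incr.
rewrite powRr1// powRr1 ?invr_ge0 ?(ltW alpha0)//.
have L0 : (0 <= Lp_norm D +oo f)%E by exact: Lnorm_ge0.
have [Loo|Lfin] := eqVneq (Lp_norm D +oo f) +oo%E.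
  rewrite Loo gt0_mulye ?leey// lte_fin mulr_gt0 ?invr_gt0// subr_gt0.
  apply: gt0_ltr_powR; rewrite ?nnegrE ?(ltW ab)//.
  exact: le_trans (ltW ab).
have fL : {ae mu, forall s, D s -> ((`|f s|)%:E <= Lp_norm D +oo f)%E}.
  rewrite /Lp_norm unlock.
  have muT : (0 < mu [set: R])%E.
    rewrite -set_itvNyy lebesgue_measure_itv /=.
    by rewrite ltry.
  rewrite muT.
  have := @ess_sup_ge _ _ _ mu (abse \o ((fun t => (`|f t|)%:E) \_ D)).
  apply: filterS => s h Ds; apply: le_trans h.
  by rewrite /= patchE mem_set//= normr_id.
have LE : Lp_norm D +oo f = (fine (Lp_norm D +oo f))%:E.
  by rewrite fineK// ge0_fin_numE// ltey.
rewrite LE in fL *; set L := fine _ in fL *.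
have L0' : 0 <= L by exact: fine_ge0.
apply: (@le_trans _ _ (\int[mu]_(s in D) (L%:E * (s `^ (alpha - 1))%:E))%E).
  apply: ge0_le_integral_ae => //.
  - by move=> s _; rewrite lee_fin mulr_ge0// powR_ge0.
  - by move=> s _; rewrite -EFinM lee_fin mulr_ge0// powR_ge0.
  - move: fL; apply: filterS => s h Ds; rewrite -EFinM lee_fin mulrC.
    by apply: ler_wpM2r; [exact: powR_ge0|have := h Ds; rewrite lee_fin].
rewrite ge0_integralZl_EFin//; last 2 first.
  - by move=> s _; rewrite lee_fin powR_ge0.
  - by apply/measurable_EFinP/measurable_funTS; exact: measurable_powR.
by rewrite integral_powR.
Qed.

Lemma weighted_integral_le_pos xi : 0 < xi -> xi < alpha ->
  (\int[mu]_(s in D) (s `^ (alpha - 1) * `|f s|)%:E <=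
    Lp_norm D (xi^-1)%:E f * (weight_norm alpha a b xi)%:E)%E.
Proof.
move=> xi0 xia.
have xi1 : 0 < 1 - xi by rewrite subr_gt0; exact: lt_le_trans alpha1.
have [phi [mphi phi0 fphi]] := strongly_measurable_norm mD sf.
have p0 : 0 < xi^-1 by rewrite invr_gt0.
have q0 : 0 < (1 - xi)^-1 by rewrite invr_gt0.
have pq : (xi^-1)^-1 + ((1 - xi)^-1)^-1 = 1 by rewrite !invrK addrC subrK.
pose f1 : R -> R := fun s => \1_D s * phi s.
pose g1 : R -> R := fun s => \1_D s * s `^ (alpha - 1).
have mf1 : measurable_fun [set: T] f1.
  by apply: measurable_funM => //; exact: measurable_indic.
have mg1 : measurable_fun [set: T] g1.
  apply: measurable_funM; first exact: measurable_indic.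
  exact: measurable_powR.
have f1ae : {ae mu, forall s : R, f1 s = ((fun t => `|f t|) \_ D) s}.
  move: fphi; apply: filterS => s h; rewrite /f1 patchE indicE.
  case: (boolP (s \in D)) => Ds; last by rewrite mul0r.
  by rewrite mul1r -h//; exact: set_mem.
have E1 : (\int[mu]_(s in D) (s `^ (alpha - 1) * `|f s|)%:E =
    'N[mu]_1[EFin \o (f1 \* g1)%R])%E.
  rewrite Lnorm1 [LHS]integral_mkcond; apply: ge0_eq_integral_ae => //.
  - move=> s _; rewrite patchE; case: ifP => // _.
    by rewrite lee_fin mulr_ge0// powR_ge0.
  - move: f1ae; apply: filterS => s h _ /=; rewrite h /g1 !patchE indicE.
    case: (boolP (s \in D)) => Ds; last by rewrite mul0r normr0.
    by rewrite mul1r ger0_norm ?mulr_ge0 ?powR_ge0// mulrC.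
have E2 : (Lp_norm D (xi^-1)%:E f = 'N[mu]_(xi^-1)%:E[EFin \o f1])%E.
  rewrite /Lp_norm unlock; congr (_ `^ _)%E.
  apply: ge0_eq_integral_ae => //.
  - by move=> s _; exact: poweR_ge0.
  - by move=> s _; exact: poweR_ge0.
  - move: f1ae; apply: filterS => s h _ /=; rewrite h !patchE.
    by case: ifP => _ //=; rewrite normr_id.
have E3 : ('N[mu]_((1 - xi)^-1)%:E[EFin \o g1] =
    (weight_norm alpha a b xi)%:E)%E.
  rewrite unlock invrK.
  rewrite (_ : (\int[mu]_x _)%E =
    (\int[mu]_(s in D) (s `^ ((alpha - xi) / (1 - xi) - 1))%:E)%E); last first.
    rewrite [RHS]integral_mkcond; apply: eq_integral => s _ /=.
    rewrite patchE /g1 indicE; case: (boolP (s \in D)) => Ds.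
      rewrite mul1r ger0_norm ?powR_ge0// -powRrM; congr (_ `^ _)%:E.
      have : 1 - xi != 0 by rewrite gt_eqF.
      move=> ?; field.
      by [].
    by rewrite mul0r normr0 powR0// gt_eqF.
  have e0 : 0 < (alpha - xi) / (1 - xi) by rewrite divr_gt0// subr_gt0.
  rewrite integral_powR// poweR_EFin /weight_norm; congr (_%:E).
  rewrite powRM ?invf_div//; first by rewrite subr_ge0; exact: pow_incr.
  by rewrite divr_ge0// ltW// subr_gt0.
by rewrite E1 E2 -E3; exact: hoelder.
Qed.

(** Hoelder's inequality against the weight s^(alpha - 1). *)
Lemma weighted_integral_le xi : 0 <= xi -> xi < alpha ->
  (\int[mu]_(s in D) (s `^ (alpha - 1) * `|f s|)%:E <=
    Lp_norm D (exponent_inv xi) f * (weight_norm alpha a b xi)%:E)%E.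
Proof.
move=> xi0 xia; rewrite /exponent_inv; case: eqVneq => [xiE|xine].
  by rewrite xiE; apply: weighted_integral_le_infty; rewrite -xiE.
by apply: weighted_integral_le_pos => //; rewrite lt_neqAle eq_sym xine.
Qed.

End WeightedHoelder.

(** * Integrability of the control term *)

Section LogWeight.
Context {R : realType}.
Local Notation mu := (@lebesgue_measure R).
Variable (tau : R).
Hypotheses (tau0 : 0 < tau) (tau1 : tau <= 1).

Let ln1 (s : R) : s <= tau -> 0 < 1 - ln s.
Proof.
move=> stau; rewrite subr_gt0; apply: le_lt_trans ltr01.
by apply: ln_le0; exact: le_trans tau1.
Qed.

Let continuous_1ln (s : R) : 0 < s -> {for s, continuous (fun s : R => 1 - ln s)}.
Proof. by move=> s0; apply: cvgB; [exact: cvg_cst|exact: continuous_ln]. Qed.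

Let is_derive_1ln (s : R) : 0 < s -> is_derive s 1 (fun s : R => 1 - ln s) (- s^-1).
Proof.
move=> s0; have h := is_derive1_ln s0.
by rewrite -(sub0r s^-1); apply: is_deriveB.
Qed.

Let continuous_inv_log (s : R) : 0 < s -> s <= tau ->
  {for s, continuous (fun s : R => s^-1 * (1 - ln s)^-1)}.
Proof.
move=> s0 st; apply: cvgM.
  by apply: cvgV; [rewrite gt_eqF|exact: cvg_id].
by apply: cvgV; [rewrite gt_eqF// ln1|exact: continuous_1ln].
Qed.

Lemma measurable_fun_inv_log :
  measurable_fun `[0, tau] (fun s : R => s^-1 * (1 - ln s)^-1).
Proof.
apply/measurable_fun_itv_obnd_cbndP.
exact: measurable_fun_continuous_oc continuous_inv_log.
Qed.

(** s^(-1) (1 - ln s)^(-2) is integrable near 0. *)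
Lemma integral_inv_log2_lty :
  (\int[mu]_(s in `[0%R, tau]) (s^-1 * (1 - ln s) ^- 2)%:E < +oo)%E.
Proof.
rewrite (@ge0_improper_FTC2 _ _ (fun s => (1 - ln s)^-1) _ _ _ _ _ 0) ?ltry//.
- move=> s s0 st; apply: cvgM.
    by apply: cvgV; [rewrite gt_eqF|exact: cvg_id].
  apply: cvgV; first by rewrite gt_eqF// exprn_gt0// ln1.
  by apply: cvgM; exact: continuous_1ln.
- move=> s s0 st.
  have h := is_derive_1ln s0.
  have := @is_deriveV _ (fun s => 1 - ln s) s _ 1 (lt0r_neq0 (ln1 st)) h.
  by rewrite /GRing.scale /= mulrNN mulrC.
- move=> s s0 st; rewrite mulr_ge0 ?invr_ge0 ?exprn_ge0 1?ltW//.
  exact: ln1.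
- apply/cvgrPdist_lt => e e0; near=> s.
  have l1 : 0 < 1 - ln s by apply: ln1; near: s; exact: nbhs_right_le.
  rewrite sub0r normrN gtr0_norm ?invr_gt0// invf_plt ?posrE//.
  rewrite ltrBrDl -ltrBrDr; near: s.
  exact: (cvgrNy_lt (@lnNy R)).
Unshelve. all: by end_near. Qed.

(** s^(-1) (1 - ln s)^(-1) is not integrable near 0. *)
Lemma integral_inv_log_infty :
  (\int[mu]_(s in `[0%R, tau]) (s^-1 * (1 - ln s)^-1)%:E = +oo)%E.
Proof.
have d s : 0 < s -> s <= tau ->
    is_derive s 1 (fun s : R => - ln (1 - ln s)) (s^-1 * (1 - ln s)^-1).
  move=> s0 st; have h := is_derive_1ln s0.
  have := @is_deriveN _ _ _ _ s 1 _ (@is_derive1_comp _ (@ln R) (fun s => 1 - ln s) s _ _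
    (is_derive1_ln (ln1 st)) h).
  by rewrite mulrN opprK mulrC.
have pos s : 0 < s -> s <= tau -> 0 <= s^-1 * (1 - ln s)^-1.
  by move=> s0 st; rewrite mulr_ge0 ?invr_ge0 1?ltW// ln1.
have pos0 s : s \in `[0, tau] -> 0 <= s^-1 * (1 - ln s)^-1.
  rewrite in_itv /= => /andP[]; rewrite le_eqVlt => /predU1P[<-|s0] st.
    by rewrite invr0 mul0r.
  exact: pos.
apply/eqyP => K K0.
(* the point where the primitive - ln (1 - ln s) takes the value
   - (K + ln (1 - ln tau)) *)
pose e := expR (1 - expR (K + ln (1 - ln tau))).
have lne : 1 - ln e = expR (K + ln (1 - ln tau)) by rewrite expRK subKr.
have e0 : 0 < e by exact: expR_gt0.
have et : e < tau.
  rewrite -ltr_ln ?posrE// -ltrN2 -(ltrD2l 1) lne expRD lnK ?posrE ?ln1//.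
  by rewrite ltr_pMl ?ln1// -[ltLHS]expR0 ltr_expR.
apply: (@le_trans _ _ (\int[mu]_(s in `[e, tau]) (s^-1 * (1 - ln s)^-1)%:E)%E).
  rewrite (FTC2_subinterval continuous_inv_log d e0 et) lne expRK -EFinB lee_fin.
  by rewrite opprK addrCA addNr addr0.
rewrite [leLHS]integral_mkcond [leRHS]integral_mkcond.
apply: ge0_le_integral_ae => //.
- move=> s _; apply: erestrict_ge0 => s'; rewrite /= in_itv /= lee_fin => /andP[h1 h2].
  by apply: pos => //; exact: lt_le_trans h1.
- by move=> s _; apply: erestrict_ge0 => s' h; rewrite lee_fin; exact: pos0.
- apply: aeW => s _; rewrite !patchE; case: ifPn => [/set_mem|_].
    rewrite /= in_itv /= => /andP[h1 h2].
    by rewrite mem_set//= in_itv /= h2 andbT (le_trans (ltW e0)).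
  by case: ifPn => // /set_mem /= /pos0; rewrite lee_fin.
Qed.

End LogWeight.

Section ControlWeight.
Context {R : realType} {Z U : normedModType R}.
Local Notation mu := (@lebesgue_measure R).

(** If zeta = 0 and alpha <= 1/2, the weight s^(alpha - 1) is not in L^2 near 0,
    and the convergence of all the control integrals leaves B = 0 as the only
    possibility: if B b <> 0 then the control s^(-1/2) (1 - ln s)^(-1) b is in
    L^2, but its control integrals diverge, as Psi(t, s) (B b) is close to B b
    for small t and s. *)
Lemma control_operator_eq0 (alpha t2 : R) (A : R -> operator Z)
    (Psi : R -> R -> Z -> Z) (B : U -> Z) :
  alpha <= 2^-1 -> 0 < t2 -> evolution_operator alpha 0 t2 A Psi ->
  bounded_linear B -> control_integrals_defined alpha 0 t2 Psi B ->
  forall b, B b = 0.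
Proof.
move=> alpha12 t20 hPsi [linB _] hBu b; apply: contrapT => /eqP Bb0.
have b0 : 0 < `|b|.
  rewrite normr_gt0; apply: contra Bb0 => /eqP ->.
  by rewrite -(scale0r 0) linear_scale// scale0r.
set z := B b in Bb0.
have z0 : 0 < `|z| by rewrite normr_gt0.
have [|d d0 hd] := within_continuous_distP (p := (0, 0)) _
  (@evo_continuous _ _ _ _ _ _ _ hPsi z) (divr_gt0 z0 (ltr0Sn R 1)).
  by split => //=; exact: ltW.
(* So small that |Psi(tau, s) z| >= |z| / 2 on [0, tau], and 1 - ln s > 0. *)
pose tau := Num.min (Num.min t2 1) (d / 2).
have tau0 : 0 < tau by rewrite !lt_min t20 ltr01 divr_gt0.
have tau1 : tau <= 1 by rewrite !ge_min lexx orbT.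
have taut2 : tau <= t2 by rewrite !ge_min lexx.
have taud : tau < d.
  apply: (@le_lt_trans _ _ (d / 2)); first by rewrite ge_min lexx orbT.
  by rewrite ltr_pdivrMr// ltr_pMr// ltr1n.
have Psi_ge s : 0 <= s -> s <= tau -> `|z| / 2 <= `|Psi tau s z|.
  move=> s0 st.
  have /= := hd (tau, s); rewrite (evo_id hPsi) ?(ltW t20)//.
  have -> : `|(0, 0) - (tau, s) : (R * R)%type| < d.
    rewrite prod_normE /= gt_max !sub0r !normrN !ger0_norm ?(ltW tau0)// taud.
    exact: le_lt_trans taud.
  move=> /(_ _ isT) h.
  have {}h : `|z - Psi tau s z| < `|z| / 2 by apply: h.
  have := ler_normD (z - Psi tau s z) (Psi tau s z); rewrite subrK; lra.
have lns s : s <= tau -> 0 < 1 - ln s.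
  move=> stau; rewrite subr_gt0; apply: le_lt_trans ltr01.
  by apply: ln_le0; exact: le_trans tau1.
pose phi (s : R) : R := s `^ (- 2^-1) * (1 - ln s)^-1.
have phi0 s : s <= tau -> 0 <= phi s.
  by move=> st; rewrite mulr_ge0 ?powR_ge0// invr_ge0 ltW// lns.
have phi2 s : 0 <= s -> phi s ^+ 2 = s^-1 * (1 - ln s) ^- 2.
  rewrite le_eqVlt => /predU1P[<-|s0]; rewrite /phi.
    by rewrite powR0 ?oppr_eq0 ?invr_eq0// mul0r expr0n invr0 mul0r.
  rewrite exprMn exprVn; congr (_ * _).
  rewrite -powR_mulrn ?powR_ge0// -powRrM mulNr mulVf ?pnatr_eq0//.
  by rewrite powR_inv1// ltW.
have cphi s : 0 < s -> s <= tau -> {for s, continuous phi}.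
  move=> s0 st; apply: cvgM.
    exact: continuous_powR.
  apply: cvgV; first by rewrite gt_eqF// lns.
  by apply: cvgB; [exact: cvg_cst|exact: continuous_ln].
pose u s : U := (\1_(`[0, tau]%classic : set R) s : R) *: ((phi s / `|b|) *: b).
have uE s : 0 <= s -> s <= tau -> u s = (phi s / `|b|) *: b.
  by move=> s0 st; rewrite /u indicE mem_set ?scale1r//= in_itv /= s0 st.
have u_norm s : 0 <= s -> s <= tau -> `|u s| = phi s.
  move=> s0 st; rewrite uE// normrZ normrM normfV normr_id.
  by rewrite divfK ?gt_eqF// ger0_norm// phi0.
have u_eq0 s : ~ (0 <= s <= tau) -> u s = 0.
  by move=> h; rewrite /u indicE memNset ?scale0r//= in_itv.
have hu : in_Lp `[0, t2] 2%:E u.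
  split.
    apply: strongly_measurable_extend; first exact: measurable_itv.
    apply: (@strongly_measurable_operator _ _ _ 0 tau tau0
      (fun s (c : U) => (phi s / `|b|) *: c) (fun=> b)).
    - by move=> s _ c x y; rewrite scalerDr !scalerA mulrC.
    - move=> s v /andP[s0 st]; apply: cvgZ; last exact: cvg_snd.
      apply: cvgMl; apply: (cvg_comp _ _ (@cvg_fst _ _ _ _ _)).
      by apply: cphi => //; exact: ltW.
    - exact: strongly_measurable_cst.
  rewrite /Lp_norm unlock; apply: poweR_lty.
  apply: le_lt_trans (integral_inv_log2_lty tau0 tau1).
  rewrite [leRHS]integral_mkcond; apply: ge0_le_integral_ae => //.
  - by move=> s _; exact: poweR_ge0.
  - move=> s _; apply: erestrict_ge0 => s'; rewrite /= in_itv /= lee_fin => /andP[s0 st].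
    by rewrite -phi2// sqr_ge0.
  - apply: aeW => s _; rewrite !patchE; case: ifPn => [_|_] /=; last first.
      rewrite normr0 powR0//.
      case: ifPn => // /set_mem /=; rewrite in_itv /= lee_fin => /andP[s0 st].
      by rewrite -phi2// sqr_ge0.
    rewrite normr_id powR_mulrn//.
    have [st|st] := boolP (0 <= s <= tau).
      rewrite mem_set//=; have /andP[s0 s1] := st.
      by rewrite u_norm// phi2.
    rewrite u_eq0; last exact/negP.
    by rewrite normr0 expr0n memNset//=; rewrite in_itv; exact/negP.
have [] := hBu u hu tau; first by rewrite in_itv /= (ltW tau0).
move=> v hv.
have mD : measurable (`[0, tau]%classic : set (measurableTypeR R)).
  exact: measurable_itv.
have muD : (mu `[0%R, tau]%classic < +oo)%E.
  by rewrite lebesgue_measure_itv /= lte_fin tau0 -EFinB ltry.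
have := is_bochner_integral_norm_lty mD muD hv.
suff -> : (\int[mu]_(t in `[0%R, tau]) (`|t `^ (alpha - 1) *: Psi tau t ((B \o u) t)|)%:E
   = +oo)%E by rewrite ltxx.
pose c := `|z| / 2 / `|b|.
have c0 : 0 < c by rewrite !divr_gt0.
apply/eqP; rewrite -leye_eq.
have <- : (\int[mu]_(s in `[0%R, tau]) (c%:E * (s^-1 * (1 - ln s)^-1)%:E) = +oo)%E.
  rewrite ge0_integralZl_EFin ?ltW//.
  - by rewrite integral_inv_log_infty// gt0_muley.
  - move=> s; rewrite /= in_itv /= lee_fin => /andP[s0 st].
    by rewrite mulr_ge0// invr_ge0// ltW// lns.
  - by apply/measurable_EFinP; exact: measurable_fun_inv_log.
apply: ge0_le_integral_ae => //.
  move=> s; rewrite /= in_itv /= => /andP[s0 st].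
  by rewrite -EFinM lee_fin !mulr_ge0 ?invr_ge0// ltW// lns.
apply: aeW => s; rewrite /= in_itv /= -EFinM lee_fin => /andP[s0 st].
have [linPsi _] : bounded_linear (Psi tau s) by exact: (evo_bounded hPsi).
rewrite uE// (linear_scale linB) (linear_scale linPsi) -/z 2!normrZ.
move: s0; rewrite le_eqVlt => /predU1P[<-|s0].
  by rewrite invr0 mul0r mulr0 mulr_ge0// mulr_ge0.
rewrite (ger0_norm (powR_ge0 _ _)) (ger0_norm (divr_ge0 (phi0 _ st) _))//.
have hpow : s^-1 <= s `^ (alpha - 1) * s `^ (- 2^-1).
  rewrite -powR_inv1 ?(ltW s0)// -powRD; last by rewrite (gt_eqF s0) implybT.
  apply: ger_powR; first by rewrite s0 (le_trans st).
  by move: alpha12; lra.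
have l0 := lns _ st.
have P0 := Psi_ge s (ltW s0) st.
rewrite /c /phi.
rewrite [leLHS](_ : _ = (s^-1 * (1 - ln s)^-1 / `|b|) * (`|z| / 2)); last by ring.
rewrite [leRHS](_ : _ = (s `^ (alpha - 1) * s `^ (- 2^-1) * (1 - ln s)^-1 / `|b|) *
  `|Psi tau s z|); last by ring.
apply: ler_pM => //.
- by rewrite !mulr_ge0 ?invr_ge0// ltW.
- by rewrite ler_wpM2r ?invr_ge0// ler_wpM2r ?invr_ge0 ?(ltW l0).
Qed.

(** If alpha > 1/2, or if zeta > 0, the weight is in L^2 over [zeta, t2], and
    otherwise B = 0. *)
Lemma control_weight_integrable (alpha t1 zeta t2 : R) (A : R -> operator Z)
    (Psi : R -> R -> Z -> Z) (B : U -> Z) (u : R -> U) :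
  0 < alpha <= 1 -> 0 <= t1 -> t1 <= zeta -> zeta < t2 ->
  evolution_operator alpha t1 t2 A Psi -> bounded_linear B ->
  control_integrals_defined alpha zeta t2 Psi B ->
  in_Lp `[zeta, t2] 2%:E u ->
  (\int[mu]_(s in `[zeta, t2]) (s `^ (alpha - 1) * `|B (u s)|)%:E < +oo)%E.
Proof.
move=> /andP[alpha0 alpha1] t10 t1z zt2 hPsi hB hBu [su Lu].
have z0 : 0 <= zeta := le_trans t10 t1z.
have mD : measurable (`[zeta, t2]%classic : set (measurableTypeR R)).
  exact: measurable_itv.
have [linB [C hC]] := hB.
(* Comparison of the weighted controls with s^(a - 1) |u s|, 1/2 < a <= 1. *)
have main a c : 2^-1 < a -> a <= 1 -> 0 <= c ->
    (forall s, s \in `[zeta, t2] -> 0 < s -> s `^ (alpha - 1) <= c * s `^ (a - 1)) ->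
    (\int[mu]_(s in `[zeta, t2]) (s `^ (alpha - 1) * `|B (u s)|)%:E < +oo)%E.
  move=> a12 a1 c0 hc.
  have C0 : 0 <= Num.max C 0 by rewrite le_max lexx orbT.
  have h2 := @weighted_integral_le _ _ a _ _ u z0 zt2 a1 su 2^-1 _ a12.
  rewrite /exponent_inv gt_eqF ?invr_gt0// invrK in h2.
  have h3 : (\int[mu]_(s in `[zeta, t2])
      (Num.max C 0 * c * (s `^ (a - 1) * `|u s|))%:E < +oo)%E.
    rewrite ge0_integralZl_strongly ?mulr_ge0//; last by move=> s; exact: powR_ge0.
    apply: lte_mul_pinfty => //; first by rewrite lee_fin mulr_ge0.
    apply: le_lt_trans (h2 _) _; first by rewrite invr_ge0.
    rewrite muleC; apply: lte_mul_pinfty => //.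
    by rewrite lee_fin weight_norm_ge0.
  apply: le_lt_trans h3; apply: ge0_le_integral_ae => //.
  - by move=> s _; rewrite lee_fin mulr_ge0 ?powR_ge0.
  - by move=> s _; rewrite lee_fin !mulr_ge0 ?powR_ge0.
  - have ne0 : {ae mu, forall s : R, s != 0}.
      exists [set 0]; split; first exact: measurable_set1.
        exact: lebesgue_measure_set1.
      by move=> s /= /negP; rewrite negbK => /eqP.
    move: ne0; apply: filterS => s s0 Ds.
    rewrite lee_fin.
    have sz : s \in `[zeta, t2] by [].
    have s_gt0 : 0 < s.
      rewrite lt_neqAle eq_sym s0; apply: le_trans z0 _.
      by move: sz; rewrite in_itv /= => /andP[].
    rewrite [leRHS](_ : _ = (c * s `^ (a - 1)) * (Num.max C 0 * `|u s|)); last by ring.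
    apply: ler_pM; rewrite ?powR_ge0//; first exact: hc.
    by apply: le_trans (hC _) _; rewrite ler_wpM2r// le_max lexx.
have [alpha12|alpha12] := ltP 2^-1 alpha.
  by apply: (main alpha 1) => // s _ _; rewrite mul1r.
move: z0; rewrite le_eqVlt => /predU1P[z0|z0]; last first.
  apply: (main 1 (zeta `^ (alpha - 1))) => //; rewrite ?powR_ge0//.
    by rewrite invf_lt1// ltr1n.
  move=> s; rewrite in_itv /= subrr powRr0 mulr1 => /andP[zs _] s0.
  rewrite -[alpha - 1]opprB !powRN lef_pV2 ?posrE ?powR_gt0//.
  by apply: ge0_ler_powR; rewrite ?nnegrE ?subr_ge0// ltW.
have t1E : t1 = 0 by apply/eqP; rewrite eq_le t10 z0 t1z.
rewrite -z0 in zt2 hBu *; rewrite t1E in hPsi.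
have B0 := control_operator_eq0 alpha12 zt2 hPsi hB hBu.
under eq_integral do rewrite B0 normr0 mulr0.
by rewrite integral0.
Qed.

End ControlWeight.

(** * Duhamel integrals *)

Section Duhamel.
Context {R : realType} {Z : completeNormedModType R}.
Local Notation mu := (@lebesgue_measure R).
Variables (alpha t1 zeta t2 : R) (A : R -> operator Z) (Psi : R -> R -> Z -> Z)
  (M : R).
Hypotheses (t10 : 0 <= t1) (t1z : t1 <= zeta).
Hypothesis hPsi : evolution_operator alpha t1 t2 A Psi.
Hypothesis M0 : 0 <= M.
Hypothesis hM : forall t s z, t1 <= s -> s <= t -> t <= t2 ->
  `|Psi t s z| <= M * `|z|.
Local Notation D := (`[zeta, t2]%classic : set (measurableTypeR R)).

Let linPsi t s : t1 <= s -> s <= t -> t <= t2 -> linear (Psi t s).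
Proof. by move=> h1 h2 h3; have [] := evo_bounded hPsi h1 h2 h3. Qed.

Let mD : measurable D. Proof. exact: measurable_itv. Qed.

Let mDt t : measurable (`[zeta, t]%classic : set (measurableTypeR R)).
Proof. exact: measurable_itv. Qed.

Let muD t : (mu `[zeta, t]%classic < +oo)%E.
Proof.
by rewrite lebesgue_measure_itv /= lte_fin; case: ifP => _; rewrite -?EFinB ltry.
Qed.

Lemma evolution_dist t s z e : t1 <= s -> s <= t -> t <= t2 -> 0 < e ->
  exists2 d, 0 < d & forall t' s', t1 <= s' -> s' <= t' -> t' <= t2 ->
    `|t - t'| < d -> `|s - s'| < d -> `|Psi t s z - Psi t' s' z| < e.
Proof.
move=> h1 h2 h3 e0.
have [|d d0 hd] := within_continuous_distP (p := (t, s)) _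
  (@evo_continuous _ _ _ _ _ _ _ hPsi z) e0; first by split.
exists d => // t' s' h1' h2' h3' tt ss.
apply: (hd (t', s')) => //=.
by rewrite prod_normE /= gt_max tt ss.
Qed.

Lemma duhamel_strongly_measurable (g : R -> Z) t : zeta <= t -> t <= t2 ->
  strongly_measurable D g ->
  strongly_measurable `[zeta, t] (fun s => s `^ (alpha - 1) *: Psi t s (g s)).
Proof.
move=> zt tt2 sg.
move: zt; rewrite le_eqVlt => /predU1P[<-|zt].
  apply: strongly_measurable_ae_eq (strongly_measurable_cst _ 0).
  exists [set zeta]; split; first exact: measurable_set1.
    exact: lebesgue_measure_set1.
  move=> s /= /not_implyP[]; rewrite in_itv /= => /andP[h1 h2] _.
  by apply/eqP; rewrite eq_le h1 h2.
apply: (@strongly_measurable_operator _ _ _ zeta t zt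
  (fun s v => s `^ (alpha - 1) *: Psi t s v)).
- move=> s /andP[zs st] c x y.
  rewrite (linPsi (le_trans t1z (ltW zs)) (ltW st) tt2).
  by rewrite scalerDr !scalerA mulrC.
- move=> s v /andP[zs st].
  have t1s : t1 < s by exact: le_lt_trans zs.
  have s0 : 0 < s by exact: le_lt_trans t1s.
  apply: cvgZ.
    apply: (cvg_comp fst (fun s : R => s `^ (alpha - 1)) _ (continuous_powR s0)).
    exact: cvg_fst.
  apply/cvgrPdist_lt => e e0.
  have M1 : 0 < M + 1 by rewrite ltr_wpDl.
  have [d d0 hd] := evolution_dist v (ltW t1s) (ltW st) tt2 (divr_gt0 e0 (ltr0Sn R 1)).
  near=> p.
  have s'1 : t1 < p.1 by near: p; apply: (cvgr_gt s) => //; exact: cvg_fst.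
  have s'2 : p.1 < t by near: p; apply: (cvgr_lt s) => //; exact: cvg_fst.
  have h1 : `|s - p.1| < d by near: p; apply: cvgr_dist_lt => //; exact: cvg_fst.
  have h2 : `|v - p.2| < e / 2 / (M + 1).
    by near: p; apply: cvgr_dist_lt; [exact: cvg_snd|rewrite !divr_gt0].
  rewrite /= (_ : Psi t s v - _ = (Psi t s v - Psi t p.1 v) + Psi t p.1 (v - p.2)).
    apply: le_lt_trans (ler_normD _ _) _; rewrite (splitr e).
    apply: ltrD; first by apply: hd => //; rewrite ?subrr ?normr0 ?ltW.
    apply: le_lt_trans (hM _ (ltW s'1) (ltW s'2) tt2) _.
    apply: (@le_lt_trans _ _ ((M + 1) * `|v - p.2|)).
      by rewrite ler_wpM2r// lerDl.
    by rewrite mulrC -ltr_pdivlMr.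
  by rewrite (linear_sub (linPsi (ltW s'1) (ltW s'2) tt2)) addrA subrK.
- apply: strongly_measurableS sg => s /=; rewrite !in_itv /= => /andP[-> h].
  exact: le_trans tt2.
Unshelve. all: by end_near. Qed.

Lemma duhamel_integrand_le (g : R -> Z) t s : zeta <= s -> s <= t -> t <= t2 ->
  `|s `^ (alpha - 1) *: Psi t s (g s)| <= M * (s `^ (alpha - 1) * `|g s|).
Proof.
move=> zs st tt2; rewrite normrZ ger0_norm ?powR_ge0// mulrCA.
by rewrite ler_wpM2l ?powR_ge0// hM// (le_trans t1z).
Qed.

Lemma duhamel_norm_integral_le (g : R -> Z) t : zeta <= t -> t <= t2 ->
  strongly_measurable D g ->
  (\int[mu]_(s in `[zeta, t]) (`|s `^ (alpha - 1) *: Psi t s (g s)|)%:E <=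
   M%:E * \int[mu]_(s in D) (s `^ (alpha - 1) * `|g s|)%:E)%E.
Proof.
move=> zt tt2 sg.
rewrite -ge0_integralZl_strongly//; last by move=> s; exact: powR_ge0.
rewrite [leLHS]integral_mkcond [leRHS]integral_mkcond; apply: ge0_le_integral_ae => //.
- by move=> s _; apply: erestrict_ge0 => s' _; rewrite lee_fin.
- by move=> s _; apply: erestrict_ge0 => s' _; rewrite lee_fin !mulr_ge0 ?powR_ge0.
apply: aeW => s _; rewrite !patchE; case: ifPn => [/set_mem /=|_].
  rewrite in_itv /= => /andP[zs st].
  rewrite mem_set /=; last by rewrite in_itv /= zs (le_trans st).
  by rewrite lee_fin; exact: duhamel_integrand_le.
by case: ifP => // _; rewrite lee_fin !mulr_ge0 ?powR_ge0.
Qed.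

Lemma duhamel_exists (g : R -> Z) t : zeta <= t -> t <= t2 ->
  strongly_measurable D g ->
  (\int[mu]_(s in D) (s `^ (alpha - 1) * `|g s|)%:E < +oo)%E ->
  exists v, is_duhamel alpha zeta Psi g t v.
Proof.
move=> zt tt2 sg ig; apply: is_bochner_exists => //.
  exact: duhamel_strongly_measurable.
apply: le_lt_trans (duhamel_norm_integral_le zt tt2 sg) _.
by apply: lte_mul_pinfty => //; rewrite lee_fin.
Qed.

Lemma duhamel_dist_le (g g' : R -> Z) t v v' : zeta <= t -> t <= t2 ->
  strongly_measurable D g -> strongly_measurable D g' ->
  is_duhamel alpha zeta Psi g t v -> is_duhamel alpha zeta Psi g' t v' ->
  ((`|v - v'|)%:E <=
    M%:E * \int[mu]_(s in D) (s `^ (alpha - 1) * `|g s - g' s|)%:E)%E.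
Proof.
move=> zt tt2 sg sg' hv hv'.
apply: le_trans (is_bochner_dist_le (mDt t) (muD t) hv hv') _.
apply: le_trans (duhamel_norm_integral_le zt tt2 (strongly_measurableB sg sg')).
rewrite le_eqVlt; apply/orP; left; apply/eqP/eq_integral => s /set_mem /=.
rewrite in_itv /= => /andP[zs st].
by rewrite (linear_sub (linPsi (le_trans t1z zs) st tt2)) scalerBr.
Qed.

(** The Duhamel integral depends continuously on its upper bound. *)
Lemma duhamel_continuous (g v : R -> Z) : strongly_measurable D g ->
  (\int[mu]_(s in D) (s `^ (alpha - 1) * `|g s|)%:E < +oo)%E ->
  (forall t, t \in `[zeta, t2] -> is_duhamel alpha zeta Psi g t (v t)) ->
  {within `[zeta, t2], continuous v}.
Proof.
move=> sg ig hv.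
(* The integrands, extended by 0 to [zeta, t2], converge at every s <> t. *)
pose H t s : Z := (\1_(`[zeta, t]%classic : set R) s : R) *:
  (s `^ (alpha - 1) *: Psi t s (g s)).
have bH t : t \in `[zeta, t2] -> is_bochner D (H t) (v t).
  move=> tD; move: (tD); rewrite in_itv /= => /andP[zt tt2].
  apply: is_bochner_extend => //; last exact: hv.
  by move=> s /=; rewrite !in_itv /= => /andP[-> h]; exact: le_trans tt2.
have Hle t s : t <= t2 -> `|H t s| <= M * (s `^ (alpha - 1) * `|g s|).
  move=> tt2; rewrite /H indicE; case: (boolP (s \in _)) => [/set_mem /=|_].
    rewrite in_itv /= scale1r => /andP[zs st].
    exact: duhamel_integrand_le.
  by rewrite scale0r normr0 !mulr_ge0 ?powR_ge0.
have seq t (tau : nat -> R) : t \in `[zeta, t2] ->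
    (forall n, tau n \in `[zeta, t2]) -> tau @ \oo --> t ->
    v (tau n) @[n --> \oo] --> v t.
  move=> tD tauD taut.
  have [phi [mphi phi0 gphi]] := strongly_measurable_norm mD sg.
  have conv : (\int[mu]_(s in D) (`|H (tau n) s - H t s|)%:E @[n --> \oo] --> 0)%E.
    apply: (@dominated_cvg0_strongly _ _ D (fun n s => H (tau n) s - H t s)
      (fun s => 2 * M * (s `^ (alpha - 1) * phi s))) => //.
    - move=> n; apply: strongly_measurableB.
        exact: is_bochner_strongly_measurable (bH _ (tauD n)).
      exact: is_bochner_strongly_measurable (bH _ tD).
    - by do 2 apply: measurable_funM => //.
    - rewrite (_ : \int[_]_(s in _) _ = \int[mu]_(s in D)
        (2 * M * (s `^ (alpha - 1) * `|g s|))%:E)%E; last first.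
        apply: ge0_eq_integral_ae => //.
        + by move=> s _; rewrite lee_fin !mulr_ge0 ?powR_ge0.
        + by move=> s _; rewrite lee_fin !mulr_ge0 ?powR_ge0.
        + by move: gphi; apply: filterS => s /[apply] ->.
      rewrite ge0_integralZl_strongly ?mulr_ge0//; last first.
        by move=> s; exact: powR_ge0.
      by apply: lte_mul_pinfty => //; rewrite lee_fin mulr_ge0.
    - move: gphi; apply: filterS => s h Ds n; rewrite -h//.
      apply: le_trans (ler_normB _ _) _.
      rewrite mulr2n mulrDl mul1r mulrDl; apply: lerD; apply: Hle.
        by have := tauD n; rewrite in_itv /= => /andP[].
      by move: tD; rewrite in_itv /= => /andP[].
    - exists [set t]; split; first exact: measurable_set1.
        exact: lebesgue_measure_set1.
      move=> s /= hs; apply: contrapT => st; apply: hs => Ds.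
      move: (Ds); rewrite in_itv /= => /andP[zs st2].
      move: tD; rewrite in_itv /= => /andP[zt tt2].
      have tau2 n : tau n <= t2 by have := tauD n; rewrite in_itv /= => /andP[].
      have [lt_st|] := ltP s t; last first.
        rewrite le_eqVlt => /predU1P[/esym //|ts].
        apply: cvg_near_cst; near=> n.
        have ns : tau n < s by near: n; exact: (cvgr_lt t taut).
        rewrite /H !indicE memNset ?memNset ?scale0r ?subrr//=.
          by rewrite in_itv /= zs => /= h; move: (le_lt_trans h ts); rewrite ltxx.
        by rewrite in_itv /= zs => /= h; move: (le_lt_trans h ns); rewrite ltxx.
      apply/cvgrPdist_lt => e e0.
      have w0 : 0 < s `^ (alpha - 1) + 1 by rewrite ltr_wpDl ?powR_ge0.
      have [d d0 hd] := evolution_dist (g s) (le_trans t1z zs) (ltW lt_st) tt2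
        (divr_gt0 e0 w0).
      near=> n.
      have sn : s < tau n by near: n; exact: (cvgr_gt t taut).
      rewrite sub0r normrN /H !indicE mem_set ?mem_set ?scale1r; last 2 first.
        by rewrite /= in_itv /= zs ltW.
        by rewrite /= in_itv /= zs ltW.
      rewrite -scalerBr normrZ ger0_norm ?powR_ge0// distrC.
      apply: (@le_lt_trans _ _ ((s `^ (alpha - 1) + 1) *
        `|Psi t s (g s) - Psi (tau n) s (g s)|)).
        by rewrite ler_wpM2r// lerDl.
      rewrite mulrC -ltr_pdivlMr//; apply: hd => //; rewrite ?subrr ?normr0 ?(ltW sn)//.
        exact: le_trans zs.
      by near: n; exact: cvgr_dist_lt.
  apply/cvgrPdist_lt => e e0; near=> n.
  rewrite -lte_fin distrC.
  apply: le_lt_trans (is_bochner_dist_le mD (muD t2) (bH _ (tauD n)) (bH _ tD)) _.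
  by near: n; exact: near_lt_ereal_cvg0 conv.
apply/subspace_continuousP => t /= tD; apply/cvgrPdist_lt => e e0.
apply: contrapT => hnear.
have bad n : exists tau, [/\ tau \in `[zeta, t2], `|t - tau| < n.+1%:R^-1
    & e <= `|v t - v tau|].
  apply: contrapT => hn; apply: hnear.
  rewrite /prop_near1 /within -nbhs_nbhs_norm; exists n.+1%:R^-1 => //=.
  move=> tau ttau tauD /=; rewrite ltNge; apply/negP => h.
  by apply: hn; exists tau.
have /choice[tau tauP] := bad.
have tauD n : tau n \in `[zeta, t2] by have [] := tauP n.
have taut : tau @ \oo --> t.
  apply/cvgrPdist_lt => d d0; near=> n.
  have [_ h _] := tauP n; apply: lt_trans h _.
  rewrite -[ltLHS]ger0_norm// -normrN -sub0r; near: n.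
  by apply: cvgr_dist_lt d0; exact: cvg_harmonic.
have /cvgrPdist_lt /(_ e e0) [n _ /(_ n (leqnn n))] := seq t tau tD tauD taut.
by have [_ _] := tauP n; rewrite leNgt => /negP.
Unshelve. all: by end_near. Qed.

End Duhamel.

(** * Contractions of the space of continuous functions *)

Section FixedPoint.
Context {R : realType} {V : completeNormedModType R}.
Variables (a b q : R) (P : (R -> V) -> R -> V).
Hypotheses (ab : a <= b) (q0 : 0 <= q) (q1 : q < 1).
Hypothesis P_continuous : forall x, {within `[a, b], continuous x} ->
  {within `[a, b], continuous (P x)}.
Hypothesis P_contracts : forall x y d, {within `[a, b], continuous x} ->
  {within `[a, b], continuous y} -> 0 <= d ->
  (forall t, t \in `[a, b] -> `|x t - y t| <= d) ->
  forall t, t \in `[a, b] -> `|P x t - P y t| <= q * d.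

Let cvg_geo (C : R) : C * q ^+ n @[n --> \oo] --> 0.
Proof.
rewrite -(mulr0 C); apply: cvgMr; apply: cvg_expr.
by rewrite ger0_norm.
Qed.

Lemma contraction_fixpoint_unique x y : {within `[a, b], continuous x} ->
  {within `[a, b], continuous y} ->
  (forall t, t \in `[a, b] -> x t = P x t) ->
  (forall t, t \in `[a, b] -> y t = P y t) ->
  forall t, t \in `[a, b] -> y t = x t.
Proof.
move=> cx cy fx fy t tD.
have [C1 C10 hC1] := within_continuous_bounded ab cx.
have [C2 C20 hC2] := within_continuous_bounded ab cy.
have h n s : s \in `[a, b] -> `|y s - x s| <= (C2 + C1) * q ^+ n.
  elim: n s => [|n IHn] s sD.
    rewrite expr0 mulr1; apply: le_trans (ler_normB _ _) _.
    by apply: lerD; [exact: hC2|exact: hC1].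
  rewrite fy// fx// exprS mulrCA; apply: P_contracts => //.
  by rewrite mulr_ge0 ?exprn_ge0// addr_ge0// ltW.
apply/eqP; rewrite -subr_eq0 -normr_le0.
rewrite -(cvg_lim _ (cvg_geo (C2 + C1)))//.
apply: limr_ge; first by apply/cvg_ex; eexists; exact: cvg_geo.
by apply: nearW => n; exact: h.
Qed.

(** The contraction principle on C([a, b]; V), by Picard iteration; functions
    are total, and their values outside [a, b] are irrelevant. *)
Lemma contraction_fixpoint_exists : exists2 x,
  {within `[a, b], continuous x} & forall t, t \in `[a, b] -> x t = P x t.
Proof.
pose x n := iter n P (fun=> 0).
have cx n : {within `[a, b], continuous (x n)}.
  by elim: n => [|n IHn]; [exact: cst_continuous|exact: P_continuous].
have [C C0 hC] := within_continuous_bounded ab (cx 1%N).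
have step n t : t \in `[a, b] -> `|x n.+1 t - x n t| <= C * q ^+ n.
  elim: n t => [|n IHn] t tD.
    by rewrite expr0 mulr1 subr0; exact: hC.
  rewrite exprS mulrCA; apply: (P_contracts (cx n.+1) (cx n)) => //.
  by rewrite mulr_ge0 ?exprn_ge0// ltW.
have q1' : 0 < 1 - q by rewrite subr_gt0.
pose c n := C / (1 - q) * q ^+ n.
have c0 n : 0 <= c n by rewrite mulr_ge0 ?exprn_ge0// divr_ge0// ltW.
have dist n k t : t \in `[a, b] -> `|x (n + k)%N t - x n t| <= c n.
  move=> tD.
  have : `|x (n + k)%N t - x n t| <= c n * (1 - q ^+ k).
    elim: k => [|k IHk]; first by rewrite addn0 subrr normr0 expr0 subrr mulr0.
    rewrite addnS -(subrK (x (n + k)%N t) (x (n + k).+1 t)) -addrA.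
    apply: le_trans (ler_normD _ _) _.
    apply: le_trans (lerD (step _ _ tD) IHk) _.
    rewrite le_eqVlt; apply/orP; left; apply/eqP.
    have := lt0r_neq0 q1' => ?.
    by rewrite /c exprD exprS; field.
  by move=> /le_trans; apply; rewrite ler_piMr// gerBl exprn_ge0.
have ccvg : c n @[n --> \oo] --> 0 by exact: cvg_geo.
pose L t := lim (x n t @[n --> \oo]).
have xL t : t \in `[a, b] -> x n t @[n --> \oo] --> L t.
  move=> tD; apply/cauchy_cvgP/cauchy_exP => e e0.
  have [N _ hN] : \forall n \near \oo, c n < e by exact: (cvgr_lt 0).
  exists (x N t); exists N => // m /= Nm.
  rewrite -ball_normE /ball_ /= distrC -(subnKC Nm).
  by apply: le_lt_trans (dist _ _ _ tD) _; apply: hN => /=.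
have distL n t : t \in `[a, b] -> `|L t - x n t| <= c n.
  move=> tD.
  have h : `|x (k + n)%N t - x n t| @[k --> \oo] --> `|L t - x n t|.
    apply: cvg_norm; apply: cvgB; last exact: cvg_cst.
    by have := xL t tD; rewrite -(cvg_shiftn n (fun k => x k t)).
  rewrite -(cvg_lim _ h)//; apply: limr_le.
    by apply/cvg_ex; eexists; exact: h.
  by apply: nearW => k; rewrite addnC; exact: dist.
have cL : {within `[a, b], continuous L}.
  apply/subspace_continuousP => t /= tD; apply/cvgrPdist_lt => e e0.
  have [N _ hN] : \forall n \near \oo, c n < e / 3.
    by apply: (cvgr_lt 0) => //; rewrite divr_gt0.
  have cN : c N < e / 3 by exact: hN (leqnn N).
  have e30 : 0 < e / 3 by rewrite divr_gt0.
  have [d d0 hd] := within_continuous_distP tD (cx N) e30.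
  rewrite /prop_near1 /within -nbhs_nbhs_norm; exists d => //= s ts sD.
  have h := hd s sD ts; rewrite -[X in X < _]/(`|L t - L s|).
  have h2 := distL N t tD; have h3 := distL N s sD.
  rewrite (_ : L t - L s = (L t - x N t) + (x N t - x N s) + (x N s - L s));
    last by rewrite !addrA !subrK.
  apply: le_lt_trans (ler_normD _ _) _.
  have := ler_normD (L t - x N t) (x N t - x N s).
  rewrite (distrC (x N s)); lra.
exists L => // t tD.
apply/eqP; rewrite -subr_eq0 -normr_le0.
have ccvg2 : c n.+1 + q * c n @[n --> \oo] --> 0 + q * 0.
  apply: cvgD; last exact: cvgMr.
  by move: ccvg; rewrite -(cvg_shiftS c).
rewrite mulr0 addr0 in ccvg2.
rewrite -(cvg_lim _ ccvg2)//; apply: limr_ge.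
  by apply/cvg_ex; eexists; exact: ccvg2.
apply: nearW => n.
rewrite -(subrK (x n.+1 t) (L t)) -addrA.
apply: le_trans (ler_normD _ _) _; apply: lerD; first exact: distL.
rewrite distrC; apply: P_contracts => //.
by move=> s sD; exact: distL.
Qed.

End FixedPoint.

(** * Existence and uniqueness of the mild solution *)

(** The Lipschitz condition between continuous functions, applied to constant
    ones, is a pointwise Lipschitz condition. *)
Lemma H4_pointwise (R : realType) (Z : normedModType R)
    (alpha zeta t2 delta xi1 : R) (rho : R -> R) (F : R -> Z -> Z) :
  zeta < t2 -> hypothesis_H4 alpha zeta t2 delta xi1 rho F ->
  forall t a b, t \in `[zeta, t2] -> `|F t a - F t b| <= rho t * `|a - b|.
Proof.
move=> zt2 H4 t a b tD.
have cW (c : Z) : `|c| <= Num.max `|a| `|b| ->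
    Wball zeta t2 (Num.max `|a| `|b| + 1) (fun=> c).
  move=> hc; split; first exact: cst_continuous.
  by move=> s _; apply: le_trans hc _; rewrite lerDl.
have r0 : 0 < Num.max `|a| `|b| + 1 by rewrite ltr_wpDl// le_max normr_ge0.
have := H4_lipschitz H4 r0 (cW a _) (cW b _) tD.
rewrite !le_max !lexx orbT => /(_ isT isT).
rewrite /sup_norm (_ : [set _ | _ in _] = [set `|a - b|]) ?sup1//.
apply/seteqP; split => x /=; first by move=> [? _ <-].
by move=> ->; exists t.
Qed.

Theorem theorem4p2 (R : realType) (Z U : completeNormedModType R)
  (ipZ : {dot Z for idfun}) (ipU : {dot U for idfun})
  (hZ : forall z : Z, `|z| ^+ 2 = ipZ z z)
  (hU : forall v : U, `|v| ^+ 2 = ipU v v)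
  (alpha t0 tf t1 t2 zeta : R)
  (halpha : 0 < alpha <= 1) (ht0 : 0 <= t0) (ht0f : t0 < tf)
  (ht1 : t1 = (alpha * t0) `^ alpha^-1) (ht2 : t2 = (alpha * tf) `^ alpha^-1)
  (hzeta : t0 <= zeta <= tf) (hzeta1 : t1 <= zeta) (hzeta2 : zeta < t2)
  (omega Kalpha K delta : R) (A : R -> operator Z)
  (hA : parabolic_family alpha t0 tf omega Kalpha K delta A)
  (Psi : R -> R -> Z -> Z) (hPsi : evolution_operator alpha t1 t2 A Psi)
  (M : R)
  (hM : forall t s z, t1 <= s -> s <= t -> t <= t2 ->
    `|Psi t s z| <= M * `|z|)
  (B : U -> Z) (hB : bounded_linear B)
  (hBu : control_integrals_defined alpha zeta t2 Psi B)
  (F : R -> Z -> Z) (xi gamma : R) (h : R -> R -> R)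
  (H1 : hypothesis_H1 alpha zeta t2 delta xi gamma h F)
  (H2 : exactly_null_controllable alpha zeta t2 Psi B xi)
  (H3 : hypothesis_H3 zeta t2 F)
  (xi1 : R) (rho : R -> R)
  (H4 : hypothesis_H4 alpha zeta t2 delta xi1 rho F)
  (hN : has_ubound (N_set alpha zeta t2 delta))
  (u : R -> U) (hu : in_Lp `[zeta, t2] 2%:E u) (x0 : Z)
  (M1 : R)
  (hM1 : M1 = fine (Lp_norm (V := R^o) `[zeta, t2] (exponent_inv xi1) rho))
  (hsmall : M * M1 * sup (N_set alpha zeta t2 delta) < 1) :
  exists x : R -> Z,
    mild_solution alpha zeta t2 Psi B F u x0 x /\
    forall y, mild_solution alpha zeta t2 Psi B F u x0 y ->
      forall t, t \in `[zeta, t2] -> y t = x t.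
Proof.
have /andP[alpha0 alpha1] := halpha.
have t10 : 0 <= t1 by rewrite ht1 powR_ge0.
have z0 : 0 <= zeta by exact: le_trans hzeta1.
pose D : set (measurableTypeR R) := `[zeta, t2]%classic.
have mD : measurable D by exact: measurable_itv.
have muD t : (lebesgue_measure `[zeta, t]%classic < +oo)%E.
  by rewrite lebesgue_measure_itv /= lte_fin; case: ifP => _; rewrite -?EFinB ltry.
have itvP t : t \in `[zeta, t2] -> zeta <= t /\ t <= t2.
  by rewrite in_itv /= => /andP[].
(* M is only known to be nonnegative when Z is nontrivial. *)
pose M' := Num.max M 0.
have M'0 : 0 <= M' by rewrite le_max lexx orbT.
have hM' t s z : t1 <= s -> s <= t -> t <= t2 -> `|Psi t s z| <= M' * `|z|.
  move=> h1 h2 h3; apply: le_trans (hM _ _ _ h1 h2 h3) _.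
  by rewrite ler_wpM2r// le_max lexx.
(* The Duhamel integral of g at t, or 0 where it does not exist. *)
pose duh (g : R -> Z) t : Z := xget 0 [set v | is_duhamel alpha zeta Psi g t v].
have duhP g : strongly_measurable D g ->
    (\int[lebesgue_measure]_(s in D) (s `^ (alpha - 1) * `|g s|)%:E < +oo)%E ->
    forall t, t \in `[zeta, t2] -> is_duhamel alpha zeta Psi g t (duh g t).
  move=> sg ig t /itvP[zt tt2]; rewrite /duh.
  apply: (@xgetPex _ 0 [set v | is_duhamel alpha zeta Psi g t v]).
  exact: (duhamel_exists t10 hzeta1 hPsi M'0 hM').
have iBu := control_weight_integrable halpha t10 hzeta1 hzeta2 hPsi hB hBu hu.
have sBu : strongly_measurable D (B \o u).
  apply: (@strongly_measurable_operator _ _ _ zeta t2 hzeta2 (fun _ c => B c)).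
  - by move=> s _; have [] := hB.
  - move=> s v _; apply: (cvg_comp snd B (@cvg_snd _ _ _ _ _)).
    exact: bounded_linear_is_continuous.
  - by have [] := hu.
have FP x : {within `[zeta, t2], continuous x} ->
    strongly_measurable D (fun s => F s (x s)) /\
    (\int[lebesgue_measure]_(s in D) (s `^ (alpha - 1) * `|F s (x s)|)%:E < +oo)%E.
  move=> cx; have [r r0 hr] := within_continuous_bounded (ltW hzeta2) cx.
  split; first by apply: (H3 r).
  have [hsm hLp] := H1_h_Lp H1 r0.
  have /andP[xi0] := H1_xi H1; rewrite lt_min => /andP[xia _].
  have hint : (\int[lebesgue_measure]_(s in D)
      (s `^ (alpha - 1) * `|h r s : R^o|)%:E < +oo)%E.
    apply: le_lt_trans (weighted_integral_le z0 hzeta2 alpha1 hsm xi0 xia) _.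
    by rewrite muleC; apply: lte_mul_pinfty; rewrite ?lee_fin ?weight_norm_ge0.
  apply: le_lt_trans hint.
  apply: ge0_le_integral_ae => //.
  - by move=> s _; rewrite lee_fin mulr_ge0 ?powR_ge0.
  - by move=> s _; rewrite lee_fin mulr_ge0 ?powR_ge0.
  - have := H1_bound H1 r0; apply: filterS => s Fh Ds.
    rewrite lee_fin ler_wpM2l ?powR_ge0//.
    apply: le_trans (ler_norm _); rewrite -lee_fin; apply: le_trans (Fh Ds).
    by apply: ereal_sup_ubound; exists (x s) => //=; exact: hr.
pose P x t : Z := Psi t zeta x0 + duh (B \o u) t + duh (fun s => F s (x s)) t.
have Pcont x : {within `[zeta, t2], continuous x} ->
    {within `[zeta, t2], continuous (P x)}.
  move=> /FP[sF iF].
  have c1 : {within `[zeta, t2], continuous (fun t => Psi t zeta x0)}.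
    apply/subspace_continuousP => t /itvP[zt tt2]; apply/cvgrPdist_lt => e e0.
    have [d d0 hd] := evolution_dist hPsi x0 hzeta1 zt tt2 e0.
    rewrite /prop_near1 /within -nbhs_nbhs_norm; exists d => //= s ts /itvP[zs st2].
    by apply: hd => //; rewrite subrr normr0.
  have c2 := duhamel_continuous hzeta1 hPsi M'0 hM' sBu iBu (duhP _ sBu iBu).
  have c3 := duhamel_continuous hzeta1 hPsi M'0 hM' sF iF (duhP _ sF iF).
  by move=> t; apply: cvgD; [apply: cvgD; [exact: c1|exact: c2]|exact: c3].
have /andP[xi10] := H4_xi1 H4; rewrite lt_min => /andP[xi1a xi1d].
have [srho Lrho] := H4_rho_Lp H4.
have [W WE] : exists W, W = weight_norm alpha zeta t2 xi1 by eexists.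
have WN : W <= sup (N_set alpha zeta t2 delta).
  rewrite WE; apply: ub_le_sup => //; exists xi1 => //=.
  by rewrite xi10 lt_min xi1a.
have W0 : 0 <= W by rewrite WE; exact: weight_norm_ge0.
have L0 : (0 <= Lp_norm (V := R^o) `[zeta, t2] (exponent_inv xi1) rho)%E.
  exact: Lnorm_ge0.
have M10 : 0 <= M1 by rewrite hM1 fine_ge0.
have M1E : Lp_norm (V := R^o) `[zeta, t2] (exponent_inv xi1) rho = M1%:E.
  by rewrite hM1 fineK// ge0_fin_numE.
pose q := M' * M1 * W.
have q0 : 0 <= q by rewrite mulr_ge0// mulr_ge0.
have q1 : q < 1.
  rewrite /q /M'; have [Mneg|Mpos] := leP M 0; first by rewrite !mul0r.
  by apply: le_lt_trans hsmall; rewrite ler_wpM2l// mulr_ge0// ltW.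
have Pcontr x y d : {within `[zeta, t2], continuous x} ->
    {within `[zeta, t2], continuous y} -> 0 <= d ->
    (forall t, t \in `[zeta, t2] -> `|x t - y t| <= d) ->
    forall t, t \in `[zeta, t2] -> `|P x t - P y t| <= q * d.
  move=> /FP[sx ix] /FP[sy iy] d0 hd t tD; have [zt tt2] := itvP t tD.
  rewrite /P opprD addrACA subrr add0r -lee_fin.
  apply: le_trans (duhamel_dist_le hzeta1 hPsi M'0 hM' zt tt2 sx sy
    (duhP _ sx ix _ tD) (duhP _ sy iy _ tD)) _.
  rewrite [leRHS](_ : _ = (M'%:E * (d * (M1 * W))%:E)%E); last first.
    by rewrite -EFinM /q; congr (_%:E); ring.
  apply: lee_wpmul2l; first by rewrite lee_fin.
  have := weighted_integral_le z0 hzeta2 alpha1 srho xi10 xi1a.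
  rewrite M1E -WE -EFinM => hW.
  apply: (@le_trans _ _ (\int[lebesgue_measure]_(s in D)
      (d * (s `^ (alpha - 1) * `|rho s : R^o|))%:E)%E).
    apply: ge0_le_integral_ae => //.
    - by move=> s _; rewrite lee_fin mulr_ge0 ?powR_ge0.
    - by move=> s _; rewrite lee_fin !mulr_ge0 ?powR_ge0.
    - apply: aeW => s Ds; rewrite lee_fin mulrCA ler_wpM2l ?powR_ge0//.
      apply: le_trans (H4_pointwise hzeta2 H4 _ _ Ds) _.
      rewrite mulrC; apply: ler_pM => //; first exact: (H4_rho_ge0 H4).
        exact: hd.
      exact: ler_norm.
  rewrite ge0_integralZl_strongly//; last by move=> s; exact: powR_ge0.
  rewrite [leRHS]EFinM.
  by apply: lee_wpmul2l hW; rewrite lee_fin.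
have mildP y : mild_solution alpha zeta t2 Psi B F u x0 y <->
    {within `[zeta, t2], continuous y} /\
    forall t, t \in `[zeta, t2] -> y t = P y t.
  split=> -[cy hy]; split => // t tD; have [sF iF] := FP y cy.
    have [v [w [hv hw ->]]] := hy t tD; rewrite /P.
    have mDt : measurable (`[zeta, t]%classic : set (measurableTypeR R)).
      exact: measurable_itv.
    congr (_ + _ + _).
      exact: (is_bochner_unique mDt (muD t) hv (duhP _ sBu iBu _ tD)).
    exact: (is_bochner_unique mDt (muD t) hw (duhP _ sF iF _ tD)).
  exists (duh (B \o u) t), (duh (fun s => F s (y s)) t).
  by split; [exact: duhP|exact: duhP|exact: hy].
have [x cx fx] := contraction_fixpoint_exists (ltW hzeta2) q0 q1 Pcont Pcontr.
exists x; split; first exact/mildP.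
move=> y /mildP[cy fy] t tD.
exact: (contraction_fixpoint_unique (ltW hzeta2) q0 q1 Pcontr cx cy fx fy).
Qed.
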